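(* Let $\mathbb{G}$ be a stratified group, let $\Omega\subset\mathbb{G}$ be open and let $u:\Omega\to\mathbb{R}$ be an h-convex function. Then for every $x\in\Omega$ and $h\in H_1$ the horizontal directional derivative $u'(x,h)$ exists and satisfies $$u'(x,h)=\max_{p\in\partial_Hu(x)}\langle p,h\rangle,$$ hence it is subadditive with respect to the variable $h$.
   Context: Stratified group: $\mathbb{G}=H_1\oplus\cdots\oplus H_\iota$ is a finite dimensional graded vector space with a polynomial group operation given by the Baker-Campbell-Hausdorff formula (so $\mathbb{G}$ is identified with its stratified Lie algebra via exponential coordinates; the unit element is $0$, and the first layer $H_1$ generates the Lie algebra). Dilations: $\delta_r(x)=\sum_jr^jx_{(j)}$ if $x=\sum_jx_{(j)}$, $x_{(j)}\in H_j$. A scalar product $\langle\cdot,\cdot\rangle$ is fixed on $\mathbb{G}$ making the $H_j$ mutually orthogonal. For $h\in H_1$ put $[0,h]=\{th:0\le t\le1\}$ and $x\cdot[0,h]=\{x\delta_th:0\le t\le1\}$. A function $u:\Omega\to\mathbb{R}$ is h-convex if for all $x,y\in\Omega$ with $x^{-1}y\in H_1$ and $x\cdot[0,x^{-1}y]\subset\Omega$ one has $u(x\delta_\lambda(x^{-1}y))\le\lambda u(y)+(1-\lambda)u(x)$ for all $\lambda\in[0,1]$. All h-convex functions are assumed measurable; they are then locally Lipschitz with respect to any homogeneous distance (Rickly). The h-subdifferential $\partial_Hu(x)$ is the set of $p\in H_1$ such that $u(xh)\ge u(x)+\langle p,h\rangle$ whenever $h\in H_1$ and $[0,h]\subset x^{-1}\Omega$.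 The horizontal directional derivative of $u$ at $x$ along $h\in H_1$ is $u'(x,h)=\lim_{\lambda\to0^+}\frac{u(x\delta_\lambda h)-u(x)}{\lambda}$, whenever this limit exists. *)

(* Defs.v *)
From HB Require Import structures.
From mathcomp Require Import all_boot all_order all_algebra.
From mathcomp Require Import sesquilinear.
From mathcomp Require Import all_classical all_reals all_analysis.
Set Implicit Arguments.
Unset Strict Implicit.
Unset Printing Implicit Defensive.
Import Order.TTheory GRing.Theory Num.Theory.
Import numFieldNormedType.Exports.
Local Open Scope classical_set_scope.
Local Open Scope ring_scope.

Section BakerCampbellHausdorff.
Context {R : realType} {V : lmodType R}.
Variables (bracket : V -> V -> V) (s : nat).

(* [w1, [w2, ... [w_(m-1), w_m] ...]] *)
Fixpoint nested_bracket (w : seq V) : V :=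
  match w with
  | [::] => 0
  | [:: a] => a
  | a :: w' => bracket a (nested_bracket w')
  end.

(* x^(r_0) y^(s_0) ... x^(r_(n-1)) y^(s_(n-1)) with (r_i, s_i) = p i *)
Definition bch_word n (p : {ffun 'I_n -> 'I_s.+1 * 'I_s.+1}) (x y : V) : seq V :=
  flatten [seq nseq (p i).1 x ++ nseq (p i).2 y | i <- enum 'I_n].

(* Dynkin's form of the Baker-Campbell-Hausdorff series log(exp x exp y),
     sum_(n >= 1) (-1)^(n-1)/n
       sum_(r_i + s_i > 0) [x^(r_1) y^(s_1) ... x^(r_n) y^(s_n)]
                           / (sum_i (r_i + s_i) * prod_i r_i! s_i!),
   for a Lie algebra that is nilpotent of step at most s: the brackets of
   length > s vanish, hence so do all the terms with n > s, r_i > s or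
   s_i > s, which are left out. *)
Definition bch (x y : V) : V :=
  \sum_(1 <= n < s.+1)
    \sum_(p : {ffun 'I_n -> 'I_s.+1 * 'I_s.+1}
           | [forall i, (0 < (p i).1 + (p i).2)%N])
      ((-1) ^+ n.-1
        / (n * (\sum_i ((p i).1 + (p i).2))
             * \prod_i ((p i).1`! * (p i).2`!))%N%:R)
      *: nested_bracket (bch_word p x y).

End BakerCampbellHausdorff.

(* The stratified Lie algebra V = H_1 (+) ... (+) H_step, identified with its
   group through exponential coordinates.  The layers are indexed by nat, with
   H_0 = 0 and H_j = 0 for j > step.  That the Baker-Campbell-Hausdorff product
   is associative is part of its being a group operation; 0 is its unit and -x
   the inverse of x (gmul0g, gmulg0, gmulVg, gmulgV). *)
Record stratified_group (R : realType) (V : vectType R) := StratifiedGroup {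
  step : nat;
  bracket : {bilinear V -> V -> V};
  layer : nat -> {vspace V};
  step_gt0 : (0 < step)%N;
  bracketxx : forall x, bracket x x = 0;
  jacobi : forall x y z,
    bracket x (bracket y z) + bracket y (bracket z x)
      + bracket z (bracket x y) = 0;
  layer0 : layer 0%N = 0%VS;
  layer_gt_step : forall j, (step < j)%N -> layer j = 0%VS;
  layer_direct : directv (\sum_(j < step.+1) layer j);
  layer_full : fullv = (\sum_(j < step.+1) layer j)%VS;
  bracket_layer : forall i j x y, x \in layer i -> y \in layer j ->
    bracket x y \in layer (i + j)%N;
  layer1_generates : forall W : {vspace V}, (layer 1 <= W)%VS ->
    (forall x y, x \in W -> y \in W -> bracket x y \in W) -> W = fullv;
  bch_assoc : associative (bch bracket step)
}.

Section StratifiedGroup.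
Context {R : realType} {V : vectType R}.
Variable G : stratified_group V.

Definition gmul (x y : V) : V := bch (bracket G) (step G) x y.
Definition ginv (x : V) : V := - x.

Definition component (j : 'I_(step G).+1) (x : V) : V :=
  sumv_pi_for (layer_full G) j x.
Definition dilation (r : R) (x : V) : V :=
  \sum_(j < (step G).+1) r ^+ j *: component j x.

Definition orthogonal_layers (ip : {dot V for idfun}) :=
  forall i j x y, i != j -> x \in layer G i -> y \in layer G j -> ip x y = 0.

Definition hsegment (h : V) : set V := [set t *: h | t in `[0, 1]].
Definition translated_hsegment (x h : V) : set V :=
  [set gmul x (dilation t h) | t in `[0, 1]].

Definition h_convex (Omega : set V) (u : V -> R) :=
  forall x y, Omega x -> Omega y ->
    gmul (ginv x) y \in layer G 1 ->
    translated_hsegment x (gmul (ginv x) y) `<=` Omega ->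
    forall l, 0 <= l <= 1 ->
      u (gmul x (dilation l (gmul (ginv x) y))) <= l * u y + (1 - l) * u x.

Definition h_subdifferential (ip : {dot V for idfun}) (Omega : set V)
    (u : V -> R) (x : V) : set V :=
  [set p | p \in layer G 1 /\
    forall h, h \in layer G 1 ->
      hsegment h `<=` gmul (ginv x) @` Omega ->
      u x + ip p h <= u (gmul x h)].

Definition h_quotient (u : V -> R) (x h : V) (l : R) : R :=
  (u (gmul x (dilation l h)) - u x) / l.

(* lim is meaningful only when h_quotient u x h converges at 0^+ *)
Definition h_derivative (u : V -> R) (x h : V) : R :=
  lim (h_quotient u x h l @[l --> 0^'+]).

End StratifiedGroup.

Section GroupLaws.
Context {R : realType} {V : vectType R}.
Variable G : stratified_group V.

Lemma nested_bracket_line (z : V) (w : seq V) :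
  (forall v, v \in w -> exists c, v = c *: z) ->
  exists2 c, nested_bracket (bracket G) w = c *: z & (1 < size w)%N -> c = 0.
Proof.
elim: w => [|a [|b w] IHw] zw; first by exists 0; rewrite ?scale0r.
  by have [|c ->] := zw a; [rewrite mem_head | exists c].
have [v vw|d E _] := IHw; first by apply: zw; rewrite in_cons vw orbT.
have [|c ca] := zw a; first by rewrite mem_head.
exists 0 => //; rewrite scale0r.
rewrite -[LHS]/(bracket G a (nested_bracket (bracket G) (b :: w))) E ca.
by rewrite linearZl_LR linearZr_LR bracketxx !scaler0.
Qed.

Lemma size_bch_word s n (p : {ffun 'I_n -> 'I_s.+1 * 'I_s.+1}) (x y : V) :
  size (bch_word p x y) = (\sum_i ((p i).1 + (p i).2))%N.
Proof.
rewrite /bch_word size_flatten /shape sumnE 2!big_map big_enum.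
by apply: eq_bigr => i _; rewrite size_cat !size_nseq.
Qed.

Lemma gmul_line (a b : R) (z : V) : gmul G (a *: z) (b *: z) = (a + b) *: z.
Proof.
rewrite /gmul /bch; set x := a *: z; set y := b *: z.
have sG := step_gt0 G; case: (step G) sG => // s _.
have short n (p : {ffun 'I_n -> 'I_s.+2 * 'I_s.+2}) :
    (1 < \sum_i ((p i).1 + (p i).2))%N ->
    nested_bracket (bracket G) (bch_word p x y) = 0.
  have [v|c ->] := @nested_bracket_line z (bch_word p x y).
    case/flattenP=> _ /mapP[i _ ->]; rewrite mem_cat.
    by case/orP=> /nseqP[-> _]; [exists a | exists b].
  by rewrite size_bch_word => c0 /c0->; rewrite scale0r.
rewrite big_nat_recl // [X in _ + X]big_nat_cond [X in _ + X]big1 ?addr0; last first.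
  move=> n /andP[/andP[n1 _] _]; apply: big1 => p /forallP p0.
  rewrite short ?scaler0 //; apply: (@leq_trans (\sum_(i < n.+1) 1)%N).
    by rewrite sum1_card card_ord.
  exact: leq_sum.
pose q (t : 'I_s.+2 * 'I_s.+2) : {ffun 'I_1 -> 'I_s.+2 * 'I_s.+2} := [ffun=> t].
pose t10 : 'I_s.+2 * 'I_s.+2 := (inord 1, ord0).
pose t01 : 'I_s.+2 * 'I_s.+2 := (ord0, inord 1).
have v10 : (t10.1 = 1%N :> nat) by rewrite inordK.
have v01 : (t01.2 = 1%N :> nat) by rewrite inordK.
have q10 : [forall i, (0 < (q t10 i).1 + (q t10 i).2)%N].
  by apply/forallP => i; rewrite ffunE v10.
have q01 : [forall i, (0 < (q t01 i).1 + (q t01 i).2)%N].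
  by apply/forallP => i; rewrite ffunE v01 addn1.
rewrite (bigD1 (q t10)) //= (bigD1 (q t01)) /=; last first.
  rewrite q01; apply/eqP => /ffunP/(_ ord0); rewrite !ffunE => -[].
  by move/(congr1 (@nat_of_ord _)); rewrite inordK.
rewrite [X in _ + (_ + X)]big1 ?addr0; last first.
  move=> p /andP[/andP[/forallP p0 p10] p01].
  rewrite short ?scaler0 // big_ord1.
  have := p0 ord0; case E : (p ord0) => [i j] /= ij.
  rewrite ltn_neqAle ij andbT; apply/eqP => ij1.
  have pE t : p ord0 = t -> p = q t.
    by move=> pt; apply/ffunP => k; rewrite ffunE [k]ord1.
  move: ij1 E; case: i {ij} => [[|[|i]] hi]; case: j => [[|[|j]] hj] //= _ E.
  - case/eqP: p01; apply: pE; rewrite E; congr pair; apply/val_inj/esym => //.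
  - case/eqP: p10; apply: pE; rewrite E; congr pair; apply/val_inj/esym => //.
have enum1 : enum 'I_1 = [:: ord0].
  by apply: (inj_map val_inj); rewrite val_enum_ord.
rewrite !big_ord1 !ffunE /bch_word enum1 /= !ffunE /= !inordK //.
by rewrite expr0 !muln1 /= invr1 !mul1r !scale1r scalerDl.
Qed.

Lemma gmul0g : left_id 0 (gmul G).
Proof.
by move=> x; rewrite -(scale0r x) -[X in gmul _ _ X]scale1r gmul_line add0r scale1r.
Qed.

Lemma gmulg0 : right_id 0 (gmul G).
Proof.
by move=> x; rewrite -(scale0r x) -[X in gmul _ X _]scale1r gmul_line addr0 scale1r.
Qed.

Lemma gmulVg : left_inverse 0 (@ginv R V) (gmul G).
Proof.
move=> x; rewrite /ginv -scaleN1r -[X in gmul _ _ X]scale1r gmul_line.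
by rewrite addNr scale0r.
Qed.

Lemma gmulgV : right_inverse 0 (@ginv R V) (gmul G).
Proof.
move=> x; rewrite /ginv -scaleN1r -[X in gmul _ X _]scale1r gmul_line.
by rewrite addrN scale0r.
Qed.

Lemma component_layer (i j : 'I_(step G).+1) x :
  x \in layer G i -> component j x = if j == i then x else 0.
Proof.
move=> xi; have cx k : component (G := G) k x \in layer G k.
  exact: (memv_sum_pi (layer_full G)).
have E : \sum_k component (G := G) k x = \sum_k (if k == i then x else 0).
  by rewrite (sumv_pi_sum (layer_full G)) ?memvf // -big_mkcond big_pred1_eq.
have /directv_sum_unique/(_ (fun k => component (G := G) k x)
  (fun k => if k == i then x else 0)) := layer_direct G.
rewrite E eqxx => /(_ (fun k _ => cx k)) U; apply/eqP.
by apply: (forall_inP (esym (U _))) => // k _; case: eqP => [->|_] //; rewrite mem0v.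
Qed.

Lemma dilation_layer1 (r : R) x : x \in layer G 1 -> dilation G r x = r *: x.
Proof.
move=> x1; have lt1 : (1 < (step G).+1)%N by rewrite ltnS step_gt0.
rewrite /dilation (bigD1 (Ordinal lt1)) //=.
rewrite (@component_layer (Ordinal lt1)) // eqxx expr1.
rewrite big1 ?addr0 // => j j1.
by rewrite (@component_layer (Ordinal lt1)) // (negbTE j1) scaler0.
Qed.

End GroupLaws.

Section Coordinates.
Context {R : realType}.

Definition closed_box n (a b : 'rV[R]_n) : set 'rV[R]_n :=
  [set x | forall i, a 0 i <= x 0 i <= b 0 i].

Definition lebesgue_outer n (A : set 'rV[R]_n) : \bar R :=
  ereal_inf [set m : \bar R |
    exists (D : set nat) (a b : nat -> 'rV[R]_n),
      [/\ forall k i, a k 0 i <= b k 0 i,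
          A `<=` \bigcup_(k in D) closed_box (a k) (b k) &
          m = \esum_(k in D) (\prod_i (b k 0 i - a k 0 i))%:E]].

Context {V : vectType R}.

(* Coordinates in a basis of V.  Neither openness nor Lebesgue measurability
   depends on the basis. *)
Definition coords (x : V) : 'rV[R]_(\dim {:V}) := passmx.rVof (vbasis {:V}) x.

Definition vopen (Omega : set V) := open (coords @` Omega).

Definition vmeasurable (A : set V) :=
  (@lebesgue_outer (\dim {:V})).-caratheodory (coords @` A).

Definition vmeasurable_fun (Omega : set V) (u : V -> R) :=
  forall Y : set (measurableTypeR R), measurable Y ->
    vmeasurable (Omega `&` u @^-1` Y).

End Coordinates.

Definition is_max {R : realType} (A : set R) (m : R) := A m /\ ubound A m.

(* Main.v *)
Require Import Defs.
From HB Require Import structures.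
From mathcomp Require Import all_boot all_order all_algebra.
From mathcomp Require Import sesquilinear.
From mathcomp Require Import all_classical all_reals all_analysis.
From mathcomp Require Import measurable_realfun lra ring.
Import Order.TTheory GRing.Theory Num.Theory.
Import numFieldNormedType.Exports.
Local Open Scope classical_set_scope.
Local Open Scope ring_scope.
Set Implicit Arguments.
Unset Strict Implicit.
Unset Printing Implicit Defensive.

(** Along a horizontal line through [x] the function [u] is convex, so the
quotients at [x] in the direction [h] decrease to a limit, and the horizontal
subgradients at [x] are the vectors [p] of the first layer such that
[ip p h <= u'(x, h)] for all horizontal [h] ([h_quotient_le],
[h_derivative_cvg]). Once [u'(x, _)] is known to be sublinear, the theorem of
Hahn-Banach provides a linear form below it with the same value at [h]
([sublinear_support]), and the scalar product turns this form into a
subgradient at which the maximum is reached ([riesz_subspace]).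

Everything therefore rests on the subadditivity of [u'(x, _)]. Convexity gives
nothing directly, since the horizontal lines through [x] do not fill a plane on
which [u] is convex. It is obtained in three steps.

At many points the derivative is linear. Let a smooth function touch [u] from
above at [y]. Its differential bounds [u'(y, h)] from above by [l h], with [l]
linear; convexity along the line of [h] yields
[u'(y, h) >= - u'(y, - h) >= l h] ([supporting_of_touching]). Such points are
dense, because [u] minus a steep paraboloid centred at [x] attains its maximum
near [x] ([supporting_dense]). This uses that [u] is continuous, as does the
passage to the limit from the points [y] to [x] in
[h_derivative_subadditive].

Upper bounds give continuity. Where [u <= M], convexity on a segment bounds the
oscillation of [u] by a small multiple of [M - u] ([h_convex_oscillation]).
Every point near [x] is joined to [x] by a fixed number of short horizontal
segments, so [u] is continuous ([h_convex_continuous]).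

Measurability gives upper bounds. Fix horizontal vectors [X_1, ..., X_k]. By
convexity [u z] is at most the maximum of [u] over the [2 ^ k] points
[z (+- t_1 X_1) ... (+- t_k X_k)], whatever the scalars [t_j]
([sign_tree_bound]). As [u] is measurable, [{u <= M}] has nearly full measure
near [x] for large [M] ([superlevel_small]). If each of these [2 ^ k] maps
restricts, in suitable [n] of the scalars, to a bi-Lipschitz chart, then the
scalars for which a leaf falls outside [{u <= M}] have small measure, and some
[t] is good for all the leaves at once ([h_convex_bounded_above]).

Both the charts and the horizontal paths come from words
[t |-> (t_1 X_1) ... (t_k X_k)] that are submersions at suitable small [t], by
letting [n] of the scalars vary. To find one, consider among all words the largest span of the partial derivatives,
translated to the origin. Since no additional letter enlarges it, this span
contains, up to a linear bijection, every conjugate of a horizontal vector;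
differentiating the conjugations, one obtains an ideal of the Lie algebra
containing its first layer, hence everything ([tangent_space_full]). Being a
submersion is then a generic condition, because the group law is polynomial
([exists_small_charts]). The calculus required is that of polynomial functions,
whose divided differences are again polynomial. *)

(** * Polynomial functions of finitely many real parameters *)

Section Polynomial.
Context {R : realType}.
Implicit Types I J : finType.

(** Presenting the polynomial functions by their constructors lets each of their
properties be proved by induction, without monomials or degrees. *)
Inductive polyf I : ((I -> R) -> R) -> Prop :=
| polyf_cst c : polyf (fun=> c)
| polyf_var i : polyf (fun t => t i)
| polyfD f g : polyf f -> polyf g -> polyf (fun t => f t + g t)
| polyfM f g : polyf f -> polyf g -> polyf (fun t => f t * g t).

Lemma polyf_ext I (f g : (I -> R) -> R) : f =1 g -> polyf f -> polyf g.
Proof. by move=> /funext ->. Qed.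

Lemma polyfN I (f : (I -> R) -> R) : polyf f -> polyf (fun t => - f t).
Proof.
move=> pf; apply: (@polyf_ext _ (fun t => -1 * f t)).
  by move=> t; rewrite mulN1r.
by apply: polyfM pf; apply: polyf_cst.
Qed.

Lemma polyfB I (f g : (I -> R) -> R) :
  polyf f -> polyf g -> polyf (fun t => f t - g t).
Proof. by move=> pf pg; apply: polyfD pf _; apply: polyfN. Qed.

Lemma polyfX I (f : (I -> R) -> R) n : polyf f -> polyf (fun t => f t ^+ n).
Proof.
move=> pf; elim: n => [|n IHn]; first exact: polyf_cst.
by apply: (@polyf_ext _ (fun t => f t * f t ^+ n)) => [t|];
  rewrite ?exprS//; apply: polyfM.
Qed.

Lemma polyf_sum I (T : Type) (r : seq T) (P : pred T) (F : T -> (I -> R) -> R) :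
  (forall a, polyf (F a)) -> polyf (fun t => \sum_(a <- r | P a) F a t).
Proof.
move=> pF; elim: r => [|a r IHr].
  by apply: polyf_ext (polyf_cst _ 0) => t; rewrite big_nil.
case Pa: (P a); last by apply: polyf_ext IHr => t; rewrite big_cons Pa.
by apply: polyf_ext (polyfD (pF a) IHr) => t; rewrite big_cons Pa.
Qed.

Lemma polyf_prod I (T : Type) (r : seq T) (P : pred T) (F : T -> (I -> R) -> R) :
  (forall a, polyf (F a)) -> polyf (fun t => \prod_(a <- r | P a) F a t).
Proof.
move=> pF; elim: r => [|a r IHr].
  by apply: polyf_ext (polyf_cst _ 1) => t; rewrite big_nil.
case Pa: (P a); last by apply: polyf_ext IHr => t; rewrite big_cons Pa.
by apply: polyf_ext (polyfM (pF a) IHr) => t; rewrite big_cons Pa.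
Qed.

Lemma polyf_comp I J (f : (I -> R) -> R) (g : I -> (J -> R) -> R) :
  polyf f -> (forall i, polyf (g i)) -> polyf (fun t => f (g^~ t)).
Proof.
move=> pf pg; elim: f / pf => [c|i|f1 f2 _ p1 _ p2|f1 f2 _ p1 _ p2].
- exact: polyf_cst.
- exact: pg.
- exact: polyfD p1 p2.
- exact: polyfM p1 p2.
Qed.

(** Divided differences are polynomials in two points, indexed by [I + I]. *)
Definition pair_env I (t s : I -> R) (a : I + I) : R :=
  match a with inl i => t i | inr i => s i end.

(** The Leibniz rule for differences keeps the coefficients polynomial, hence
bounded and continuous: this replaces the differential calculus below. *)
Lemma polyf_divided_difference I (f : (I -> R) -> R) : polyf f ->
  exists2 M : I -> (I + I -> R) -> R, forall i, polyf (M i) &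
    forall t s, f t - f s = \sum_i M i (pair_env t s) * (t i - s i).
Proof.
have pleft g : polyf g -> polyf (fun a : I + I -> R => g (a \o inl)).
  by move=> pg; apply: (polyf_comp (g := fun i a => a (inl i)) pg) => i; apply: polyf_var.
have pright g : polyf g -> polyf (fun a : I + I -> R => g (a \o inr)).
  by move=> pg; apply: (polyf_comp (g := fun i a => a (inr i)) pg) => i; apply: polyf_var.
move=> pf; elim: f / pf => [c|i|f g pf [M pM fM] pg [N pN gN]|f g pf [M pM fM] pg [N pN gN]].
- exists (fun _ _ => 0) => [i|t s]; first exact: polyf_cst.
  by rewrite subrr big1 // => i _; rewrite mul0r.
- exists (fun j _ => (j == i)%:R) => [j|t s]; first exact: polyf_cst.
  rewrite (bigD1 i) //= eqxx mul1r big1 ?addr0 // => j /negbTE->.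
  by rewrite mul0r.
- exists (fun i a => M i a + N i a) => [i|t s]; first exact: polyfD.
  rewrite opprD addrACA fM gN -big_split /=; apply: eq_bigr => i _.
  by rewrite mulrDl.
- exists (fun i a => M i a * g (a \o inl) + f (a \o inr) * N i a) => [i|t s].
    by apply: polyfD; apply: polyfM => //; [apply: pleft | apply: pright].
  have -> : f t * g t - f s * g s = (f t - f s) * g t + f s * (g t - g s) by ring.
  rewrite fM gN mulr_suml mulr_sumr -big_split /=; apply: eq_bigr => i _.
  by rewrite /comp /= -[fun x => t x]/t; ring.
Qed.

Lemma polyf_bounded I (f : (I -> R) -> R) (B : R) : polyf f ->
  exists2 C, 0 < C & forall t, (forall i, `|t i| <= B) -> `|f t| <= C.
Proof.
move=> pf; elim: f / pf => [c|i|f g _ [C C0 fC] _ [D D0 gD]|f g _ [C C0 fC] _ [D D0 gD]].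
- by exists (`|c| + 1) => [|t _]; rewrite ?ltr_wpDl // lerDl.
- exists (`|B| + 1) => [|t tB]; first by rewrite ltr_wpDl.
  by rewrite (le_trans (tB i)) // (le_trans (ler_norm B)) // lerDl.
- exists (C + D) => [|t tB]; first exact: addr_gt0.
  by rewrite (le_trans (ler_normD _ _)) // lerD ?fC ?gD.
- exists (C * D) => [|t tB]; first exact: mulr_gt0.
  by rewrite normrM ler_pM ?fC ?gD.
Qed.

Lemma polyf_lipschitz I (f : (I -> R) -> R) (B : R) : polyf f ->
  exists2 C, 0 < C & forall t s e, 0 <= e -> (forall i, `|t i| <= B) ->
    (forall i, `|s i| <= B) -> (forall i, `|t i - s i| <= e) ->
    `|f t - f s| <= C * e.
Proof.
move=> /polyf_divided_difference[M pM fM].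
have /choice[C CP] : forall i, exists C, 0 < C /\
    forall a, (forall j, `|a j| <= B) -> `|M i a| <= C.
  by move=> i; have [C C0 MC] := polyf_bounded B (pM i); exists C.
exists (1 + \sum_i C i) => [|t s e e0 tB sB te].
  by rewrite ltr_pwDl // sumr_ge0 // => i _; rewrite ltW // (CP i).1.
rewrite fM (le_trans (ler_norm_sum _ _ _)) // mulrDl mul1r mulr_suml.
rewrite ler_wpDl //; apply: ler_sum => i _; rewrite normrM ler_pM //.
by apply: (CP i).2 => -[j|j] /=.
Qed.

Lemma polyf_continuous I (f : (I -> R) -> R) (s : I -> R) (e : R) : polyf f ->
  0 < e -> exists2 d, 0 < d &
    forall t, (forall i, `|t i - s i| <= d) -> `|f t - f s| < e.
Proof.
move=> pf e0; pose B := 1 + \sum_i `|s i|.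
have sB i : `|s i| <= B - 1.
  by rewrite /B addrAC subrr add0r (bigD1 i) //= lerDl sumr_ge0.
have [C C0 fC] := polyf_lipschitz B pf.
pose d := Num.min 1 (e / (2 * C)); have d0 : 0 < d.
  by rewrite lt_min ltr01 divr_gt0 // mulr_gt0.
have de : C * d < e.
  have dC : d <= e / (2 * C) by rewrite ge_min lexx orbT.
  rewrite mulrC -ltr_pdivlMr // (le_lt_trans dC) // ltr_pM2l //.
  by rewrite ltf_pV2 ?posrE ?mulr_gt0 // ltr_pMl // ltr1n.
exists d => // t td; apply: le_lt_trans de; apply: fC => // [|i|i]; first exact: ltW.
  have : d <= 1 by rewrite ge_min lexx.
  have := ler_normD (t i - s i) (s i); rewrite subrK.
  by have := sB i; have := td i; lra.
by have := sB i; lra.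
Qed.

(** Restriction to a line reduces questions about zeros to one variable. *)
Lemma polyf_line I (f : (I -> R) -> R) (a b : I -> R) : polyf f ->
  exists p : {poly R}, forall x, f (fun i => a i + x * b i) = p.[x].
Proof.
move=> pf; elim: f / pf => [c|i|f g _ [p fp] _ [q gq]|f g _ [p fp] _ [q gq]].
- by exists c%:P => x; rewrite hornerC.
- by exists ((a i)%:P + 'X * (b i)%:P) => x; rewrite !hornerE.
- by exists (p + q) => x; rewrite hornerD fp gq.
- by exists (p * q) => x; rewrite hornerM fp gq.
Qed.

Lemma poly_small_nonroot (p : {poly R}) (d : R) : p != 0 -> 0 < d ->
  exists2 x, 0 < x <= d & p.[x] != 0.
Proof.
move=> p0 d0; apply: contrapT => noroot.
pose s := [seq d / n.+1%:R | n <- iota 0 (size p)].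
have : (size s < size p)%N.
  apply: max_poly_roots => //.
    apply/allP => _ /mapP[n _ ->]; apply/rootP/eqP/negPn/negP => pn.
    apply: noroot; exists (d / n.+1%:R); rewrite // divr_gt0 //=.
    by rewrite ler_pdivrMr // ler_peMr ?(ltW d0) // ler1n.
  rewrite map_inj_uniq ?iota_uniq // => m n /(mulfI (lt0r_neq0 d0)).
  by move/invr_inj/eqP; rewrite eqr_nat => /eqP[].
by rewrite size_map size_iota ltnn.
Qed.

(** Nonzero polynomials have a common point of nonvanishing near [0]: move from a
point that suits some of them towards one that suits the next, along a line on
which their product has finitely many zeros. *)
Lemma polyf_common_nonroot I (T : Type) (r : seq T) (F : T -> (I -> R) -> R) e :
  (forall a, polyf (F a)) -> (forall a, exists t, F a t != 0) -> 0 < e ->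
  exists2 t, forall i, `|t i| < e & all (fun a => F a t != 0) r.
Proof.
move=> pF F0 e0; elim: r => [|a r [s se sr]].
  by exists (fun=> 0) => // i; rewrite normr0.
have [q Fq] := F0 a; pose b i := q i - s i.
have [p pP] := polyf_line s b (polyfM (pF a) (polyf_prod r predT pF)).
have [pa paP] := polyf_line s b (pF a).
have [pr prP] := polyf_line s b (polyf_prod r predT pF).
have pa0 : pa != 0.
  apply: contraNneq Fq => pa0; have := paP 1; rewrite pa0 horner0.
  have -> : (fun i => s i + 1 * b i) = q.
    by apply/funext => i; rewrite mul1r /b addrC subrK.
  by move=> ->.
have pr0 : pr != 0.
  apply/negP => /eqP pr0; have := prP 0; rewrite pr0 horner0.
  have -> : (fun i => s i + 0 * b i) = s by apply/funext => i; rewrite mul0r addr0.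
  by apply/eqP; rewrite prodf_seq_neq0.
have : pa * pr != 0 by rewrite mulf_neq0.
pose m := \sum_i `|b i|; have bm i : `|b i| <= m.
  by rewrite /m (bigD1 i) //= lerDl sumr_ge0.
(* a step [x <= d] along the line stays in the open cube of radius [e] *)
have [d d0 dP] : exists2 d, 0 < d & forall i, d * m < e - `|s i|.
  case: (pselect (inhabited I)) => [[i0]|noI]; last first.
    by exists 1 => // i; case: noI.
  have m0 : 0 <= m by rewrite sumr_ge0.
  pose g := \big[Num.min/e - `|s i0|]_i (e - `|s i|).
  have g0 : 0 < g.
    rewrite /g; elim/big_ind : _ => [|x y x0 y0|i _]; rewrite ?subr_gt0 //.
    by rewrite lt_min x0.
  exists (g / (m + 1)) => [|i]; first by rewrite divr_gt0 // ltr_pwDr.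
  have gi : g <= e - `|s i| by rewrite /g bigmin_le_cond.
  apply: lt_le_trans gi; rewrite mulrAC ltr_pdivrMr ?ltr_pwDr //.
  by rewrite ltr_pM2l // ltrDl.
move=> p0; have [x /andP[x0 xd] xP] := poly_small_nonroot p0 d0.
exists (fun i => s i + x * b i) => [i|].
  rewrite (le_lt_trans (ler_normD _ _)) // -ltrBrDl normrM gtr0_norm //.
  by apply: le_lt_trans (dP i); rewrite ler_pM // ltW.
move: xP; rewrite hornerM mulf_eq0 negb_or -paP -prP => /andP[xa xr] /=.
by rewrite xa /=; move: xr; rewrite prodf_seq_neq0.
Qed.

(** A polynomial in one variable that is constant on the positive half-line is
constant; this computes derivatives at [0] from difference quotients. *)
Lemma polyf_extend0 (I : finType) (f : (I -> R) -> R) (b : I -> R) c : polyf f ->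
  (forall x, 0 < x -> f (fun i => x * b i) = c) -> f (fun=> 0) = c.
Proof.
move=> pf fc; have [p pP] := polyf_line (fun=> 0) b pf.
have E x : f (fun i => x * b i) = p.[x].
  by rewrite -pP; congr f; apply/funext => i; rewrite add0r.
have -> : f (fun=> 0) = p.[0] by rewrite -E; congr f; apply/funext => i; rewrite mul0r.
have [|pc] := eqVneq (p - c%:P) 0.
  by move/eqP; rewrite subr_eq0 => /eqP ->; rewrite hornerC.
have [x /andP[x0 _]] := poly_small_nonroot pc ltr01.
by rewrite hornerD hornerN hornerC -E fc // subrr eqxx.
Qed.

(** Letting the point tend to [0] along its ray, the divided differences become
constants. *)
Lemma polyf_homogeneous_linear (I : finType) (f : (I -> R) -> R) : polyf f ->
  (forall x t, 0 < x -> f (fun i => x * t i) = x * f t) ->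
  exists c : I -> R, forall t, f t = \sum_i c i * t i.
Proof.
move=> pf fZ; have [M pM fM] := polyf_divided_difference pf.
have f0 : f (fun=> 0) = 0.
  have := fZ 2 (fun=> 0) (ltr0n _ 2); rewrite (_ : (fun=> _) = (fun=> 0)); first by lra.
  by apply/funext => i; rewrite mulr0.
exists (fun i => M i (fun=> 0)) => t.
pose h (a : I + I -> R) := \sum_i M i a * t i.
have ph : polyf h by apply: polyf_sum => i; apply: polyfM => //; apply: polyf_cst.
rewrite -[RHS]/(h (fun=> 0)); apply/esym.
apply: (polyf_extend0 (b := pair_env t (fun=> 0)) ph) => x x0.
have := fM (fun i => x * t i) (fun=> 0); rewrite f0 subr0 fZ // => E.
apply: (mulfI (lt0r_neq0 x0)); rewrite E /h mulr_sumr; apply: eq_bigr => i _.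
rewrite subr0 mulrCA; congr (M i _ * _); apply/funext => -[j|j] //=.
by rewrite mulr0.
Qed.

End Polynomial.

Section RowVectors.
Context {R : realType}.

Lemma rV_norm_le n (v : 'rV[R]_n) e : 0 <= e -> (`|v| <= e) <-> (forall i, `|v 0 i| <= e).
Proof.
move=> e0; split => [ve i|ve].
  by apply: le_trans ve; rewrite [`|v|]mx_normrE (le_bigmax _ _ (0, i)).
rewrite [`|v|]mx_normrE; apply/bigmax_leP; split => // -[i j] _ /=.
by rewrite ord1.
Qed.

Lemma rV_norm_lt n (v : 'rV[R]_n) e : 0 < e -> (`|v| < e) <-> (forall i, `|v 0 i| < e).
Proof.
move=> e0; split => [ve i|ve].
  by apply: le_lt_trans ve; rewrite [`|v|]mx_normrE (le_bigmax _ _ (0, i)).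
rewrite [`|v|]mx_normrE; apply/bigmax_ltP; split => // -[i j] _ /=.
by rewrite ord1.
Qed.

Lemma rV_coord_norm n (v : 'rV[R]_n) i : `|v 0 i| <= `|v|.
Proof. by have /rV_norm_le := lexx `|v|; apply. Qed.

Lemma rV_subE n (v w : 'rV[R]_n) i : (v - w) 0 i = v 0 i - w 0 i.
Proof. by rewrite !mxE. Qed.

End RowVectors.

(** * A local inverse theorem for polynomial maps *)

HB.instance Definition _ (R : realType) (m n : nat) := Complete.on 'M[R]_(m, n).

Section LocalInverse.
Context {R : realType}.
Variable n : nat.

Lemma mulmx_norm_le (v : 'rV[R]_n) (B : 'M[R]_n) c :
  0 <= c -> (forall i j, `|B i j| <= c) -> `|v *m B| <= n%:R * c * `|v|.
Proof.
move=> c0 Bc; apply/rV_norm_le => [|j]; first by rewrite !mulr_ge0.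
rewrite mxE (le_trans (ler_norm_sum _ _ _)) //.
apply: (@le_trans _ _ (\sum_(i < n) `|v| * c)).
  by apply: ler_sum => i _; rewrite normrM ler_pM // rV_coord_norm.
by rewrite sumr_const card_ord -[leLHS]mulr_natl -mulrA [c * _]mulrC.
Qed.

Variables (g : 'I_n -> ('I_n -> R) -> R) (A : 'M[R]_n).
Hypothesis pg : forall j, polyf (g j).
Hypothesis gA : forall i j x,
  g j (fun k => x *+ (k == i)) - g j (fun=> 0) = x * A i j.
Hypothesis A_unit : A \in unitmx.

Let G (t : 'rV[R]_n) : 'rV[R]_n := \row_j g j (t 0).

(** The divided differences are continuous and equal [A] at [(0, 0)]. *)
Lemma polyf_strict_derivative e : 0 < e -> exists2 d, 0 < d &
  forall t s, `|t| <= d -> `|s| <= d -> `|(t - s) *m A - (G t - G s)| <= e * `|t - s|.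
Proof.
move=> e0.
have /choice[M /all_and2[pM fM]] : forall j, exists M : 'I_n -> ('I_n + 'I_n -> R) -> R,
    (forall i, polyf (M i)) /\
    forall t s, g j t - g j s = \sum_i M i (pair_env t s) * (t i - s i).
  move=> j; have [M pM fM] := polyf_divided_difference (pg j).
  by exists M; split; [exact: pM | exact: fM].
have M0 i j : M j i (fun=> 0) = A i j.
  apply: (polyf_extend0 (b := pair_env (fun k => (k == i)%:R) (fun=> 0)) (pM j i)) => x x0.
  have -> : (fun a => x * pair_env (fun k => (k == i)%:R) (fun=> 0) a) =
      pair_env (fun k => x *+ (k == i)) (fun=> 0).
    by apply/funext => -[k|k] /=; rewrite ?mulr0 // mulr_natr.
  have := gA i j x; rewrite fM (bigD1 i) //= eqxx mulr1n subr0.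
  rewrite big1 ?addr0 => [|k /negbTE->]; last by rewrite subrr mulr0.
  by rewrite mulrC => /(mulfI (lt0r_neq0 x0)).
pose e' := e / n.+1%:R; have e'0 : 0 < e' by rewrite divr_gt0.
have /choice[d /all_and2[d0 dP]] : forall k : 'I_n * 'I_n, exists d, 0 < d /\
    forall a, (forall i, `|a i - 0| <= d) -> `|M k.2 k.1 a - A k.1 k.2| < e'.
  move=> [i j] /=; have [d d0 dP] := polyf_continuous (fun=> 0) (pM j i) e'0.
  by exists d; split=> // a /dP; rewrite M0.
pose D := \big[Num.min/1]_k d k.
have D0 : 0 < D by rewrite /D; elim/big_ind : _ => // x y x0 y0; rewrite lt_min x0.
exists D => // t s tD sD.
pose B : 'M[R]_n := \matrix_(i, j) (A i j - M j i (pair_env (t 0) (s 0))).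
have -> : (t - s) *m A - (G t - G s) = (t - s) *m B.
  apply/rowP => j; rewrite !mxE fM -sumrB; apply: eq_bigr => i _.
  by rewrite !mxE; ring.
apply: (@le_trans _ _ (n%:R * e' * `|t - s|)).
  apply: mulmx_norm_le => [|i j]; first exact: ltW.
  rewrite mxE distrC; apply/ltW/(dP (i, j)) => k; rewrite subr0.
  have Dd : D <= d (i, j) by rewrite /D bigmin_le_cond.
  apply: le_trans Dd; case: k => k /=; apply: le_trans (rV_coord_norm _ _) _ => //.
rewrite ler_wpM2r // /e' mulrA ler_pdivrMr // mulrC ler_pM2l // ler_nat //.
Qed.

(** The increment estimate makes the Newton map of [G] at [0] a contraction,
whatever the value aimed at. *)
Lemma polyf_local_inverse : exists d C, [/\ 0 < d, 0 < C,
  forall t s, `|t| <= d -> `|s| <= d -> `|t - s| <= C * `|G t - G s| &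
  forall r, 0 < r <= d -> exists2 r', 0 < r' &
    forall y, `|y - G 0| < r' -> exists2 t, `|t| <= r & G t = y].
Proof.
pose B := invmx A; pose b := 1 + \sum_i \sum_j `|B i j|.
have b0 : 0 < b by rewrite ltr_pwDl // sumr_ge0 // => i _; apply: sumr_ge0.
have Bb i j : `|B i j| <= b.
  rewrite /b (bigD1 i) //= (bigD1 j) //= ler_wpDl // -addrA lerDl addr_ge0 ?sumr_ge0 //.
  by move=> k _; apply: sumr_ge0.
pose c := n.+1%:R * b; have c0 : 0 < c by rewrite mulr_gt0.
have Bc (v : 'rV[R]_n) : `|v *m B| <= c * `|v|.
  apply: le_trans (mulmx_norm_le v (ltW b0) Bb) _.
  by rewrite ler_wpM2r // ler_wpM2r ?(ltW b0) // ler_nat.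
have [|d d0 dP] := @polyf_strict_derivative (2 * c)^-1; first by rewrite invr_gt0 mulr_gt0.
have est t s : `|t| <= d -> `|s| <= d ->
    `|(t - s) - (G t - G s) *m B| <= 2^-1 * `|t - s|.
  move=> td sd; have -> : (t - s) - (G t - G s) *m B = ((t - s) *m A - (G t - G s)) *m B.
    by rewrite [RHS]mulmxBl /B mulmxK.
  rewrite (le_trans (Bc _)) // (le_trans (ler_wpM2l (ltW c0) (dP _ _ td sd))) //.
  by rewrite mulrA invfM [_^-1 * _]mulrC mulrA mulfV ?mul1r ?lt0r_neq0.
exists d, (2 * c); split=> //; first by rewrite mulr_gt0.
  move=> t s td sd; have := est t s td sd; have := Bc (G t - G s).
  have := ler_normD ((t - s) - (G t - G s) *m B) ((G t - G s) *m B).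
  by rewrite subrK; lra.
move=> r /andP[r0 rd]; exists (r / (2 * c)); first by rewrite divr_gt0 // mulr_gt0.
move=> y yr; pose U := [set t : 'rV[R]_n | `|t| <= r].
pose psi t := t - (G t - y) *m B.
have psiB t s : psi t - psi s = (t - s) - (G t - G s) *m B.
  rewrite /psi !mulmxBl; set a := G t *m B; set b' := G s *m B; set e := y *m B.
  by apply/rowP => j; rewrite !mxE; ring.
have psiU : set_fun U U psi.
  move=> t /= tr; have := est t 0 (le_trans tr rd).
  rewrite normr0 ltW // -psiB subr0 => /(_ isT) ht.
  have := ler_normD (psi t - psi 0) (psi 0); rewrite subrK.
  have : `|psi 0| <= r / 2.
    rewrite /psi sub0r normrN -normrN -mulNmx opprB (le_trans (Bc _)) //.
    by have := ltW yr; rewrite ler_pdivlMr ?mulr_gt0 //; lra.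
  by move: tr; rewrite /U /=; lra.
have Ucl : closed U.
  apply: (@closed_comp _ _ (fun t : 'rV[R]_n => `|t|) [set x | x <= r]) => [t _|].
    exact: norm_continuous.
  exact: closed_le.
have [|||t Ut fixt] := @banach_fixed_point R _ U (mkfun_fun psiU).
- exists (2^-1)%:nng; split => /=; first by lra.
  by move=> [t s] /= [Ut Us]; rewrite psiB est // (le_trans _ rd).
- exact: Ucl.
- by exists 0; rewrite /U /= normr0 ltW.
exists t => //; apply/eqP; rewrite -subr_eq0; apply/eqP.
move: fixt; rewrite /= /mkfun /psi => /eqP; rewrite eq_sym -subr_eq0 addrAC subrr add0r oppr_eq0.
by move=> /eqP/(congr1 (mulmx^~ A)); rewrite mulmxKV // mul0mx.
Qed.

End LocalInverse.

(** * Lebesgue outer measure and Lipschitz maps *)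

Section OuterMeasure.
Context {R : realType} {n : nat}.
Implicit Types (A B : set 'rV[R]_n).
Local Notation mu := (@lebesgue_outer R n).
Local Notation vol a b := (\prod_i ((b : 'rV[R]_n) 0 i - (a : 'rV[R]_n) 0 i))%:E.
Local Open Scope ereal_scope.

Lemma box_vol_ge0 (a b : 'rV[R]_n) : (forall i, a 0 i <= b 0 i)%R -> 0 <= vol a b.
Proof. by move=> ab; rewrite lee_fin prodr_ge0 // => i _; rewrite subr_ge0. Qed.

Lemma lebesgue_outer_le (K : countType) (D : set K) (a b : K -> 'rV[R]_n) A :
  (forall k i, a k 0 i <= b k 0 i)%R ->
  A `<=` \bigcup_(k in D) closed_box (a k) (b k) ->
  mu A <= \esum_(k in D) vol (a k) (b k).
Proof.
move=> ab AD; apply: ereal_inf_lbound.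
exists (pickle @` D), (fun k => oapp a 0%R (unpickle k)), (fun k => oapp b 0%R (unpickle k)).
split.
- by move=> k i; case: (unpickle k) => [k'|] /=.
- by move=> x /AD[k Dk xk]; exists (pickle k); [exists k | rewrite pickleK].
- rewrite esum_image; last by move=> k l _ _ /(pcan_inj pickleK).
  by apply: eq_esum => k _; rewrite pickleK.
Qed.

Lemma lebesgue_outer_ge0 A : 0 <= mu A.
Proof.
apply: le_ereal_inf_tmp => _ [D [a [b [ab _ ->]]]].
by apply: esum_ge0 => k _; apply: box_vol_ge0.
Qed.

Lemma lebesgue_outer0 : mu set0 = 0.
Proof.
apply/eqP; rewrite eq_le lebesgue_outer_ge0 andbT.
rewrite (le_trans (@lebesgue_outer_le nat set0 (fun=> 0%R) (fun=> 0%R) _ _ _)) //.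
by rewrite esum_set0.
Qed.

Lemma le_lebesgue_outer A B : A `<=` B -> mu A <= mu B.
Proof.
move=> AB; apply: le_ereal_inf_tmp => _ [D [a [b [ab BD ->]]]].
by apply: lebesgue_outer_le => //; apply: subset_trans BD.
Qed.

Lemma lebesgue_outer_box (a b : 'rV[R]_n) :
  (forall i, a 0 i <= b 0 i)%R -> mu (closed_box a b) <= vol a b.
Proof.
move=> ab.
rewrite (le_trans (@lebesgue_outer_le nat [set 0%N] (fun=> a) (fun=> b) _ _ _)) //.
  by move=> x xab; exists 0%N.
by rewrite esum_set1 // box_vol_ge0.
Qed.

Lemma lebesgue_outer_sigma_subadditive : sigma_subadditive mu.
Proof.
move=> A; have [[i ioo]|] := pselect (exists i, mu (A i) = +oo).
  rewrite (eseries_pinfty _ _ ioo) ?leey// => k _.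
  by rewrite -ltNye (lt_le_trans _ (lebesgue_outer_ge0 _)).
rewrite -forallNE => Aoo.
apply/lee_addgt0Pr => e e0.
rewrite (le_trans _ (epsilon_trick _ _ (ltW e0)))//; last first.
  by move=> k; exact: lebesgue_outer_ge0.
pose P k (c : set nat * ((nat -> 'rV[R]_n) * (nat -> 'rV[R]_n))) :=
  [/\ forall j i, (c.2.1 j 0 i <= c.2.2 j 0 i)%R,
      A k `<=` \bigcup_(j in c.1) closed_box (c.2.1 j) (c.2.2 j) &
      \esum_(j in c.1) vol (c.2.1 j) (c.2.2 j) <= mu (A k) + (e / (2 ^ k.+1)%:R)%:E].
have /choice[c cP] k : exists c, P k c.
  have ek : (0 < e / (2 ^ k.+1)%:R)%R by rewrite divr_gt0 // ltr0n expn_gt0.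
  have fk : mu (A k) \is a fin_num.
    rewrite fin_numE -ltNye (lt_le_trans _ (lebesgue_outer_ge0 _)) //=.
    by apply/eqP; apply: Aoo.
  have [_ [D [a [b [ab AD ->]]]] mD] := lb_ereal_inf_adherent ek fk.
  by exists (D, (a, b)); split => //; apply: ltW.
pose a k := (c k).2.1; pose b k := (c k).2.2; pose D k := (c k).1.
apply: (@le_trans _ _ (\esum_(k in [set: nat] `*`` D) vol (a k.1 k.2) (b k.1 k.2))).
  apply: lebesgue_outer_le => [k i|x [k _ xk]]; first by have [+ _ _] := cP k.1; apply.
  have [_ /(_ _ xk)[j Dj xj] _] := cP k; exists (k, j) => //.
rewrite -(@esum_esum _ _ _ _ D (fun k j => vol (a k j) (b k j))) => [|k j _ _]; last first.
  by apply: box_vol_ge0 => i; have [+ _ _] := cP k; apply.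
rewrite [leRHS]nneseries_esumT; last first.
  by move=> k; rewrite adde_ge0 ?lebesgue_outer_ge0 // lee_fin divr_ge0 ?ltW.
by apply: le_esum => k _; have [] := cP k.
Qed.

HB.instance Definition _ := isOuterMeasure.Build R 'rV[R]_n mu
  lebesgue_outer0 lebesgue_outer_ge0 le_lebesgue_outer lebesgue_outer_sigma_subadditive.

Lemma lebesgue_outer_bigsetU (T : Type) (r : seq T) (P : pred T) (S : T -> set 'rV[R]_n) :
  mu (\big[setU/set0]_(k <- r | P k) S k) <= \sum_(k <- r | P k) mu (S k).
Proof.
elim: r => [|k r IHr]; first by rewrite !big_nil lebesgue_outer0.
rewrite !big_cons; case: (P k) => //.
by apply: le_trans (outer_measureU2 mu _ _) _; rewrite leeD2l.
Qed.

(** The traces of the sets [E k] on [B] have summable measures, so the tails of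
the series are small. *)
Lemma lebesgue_outer_exhaustion (E : nat -> set 'rV[R]_n) B (e : R) :
  (forall k, mu.-caratheodory (E k)) -> trivIset setT E ->
  B `<=` \bigcup_k E k -> mu B < +oo -> (0 < e)%R ->
  exists N, mu (B `&` \bigcup_(k in ~` `I_N) E k) < e%:E.
Proof.
move=> mE tE BE Boo e0.
have sB : \sum_(k <oo) mu (B `&` E k) < +oo.
  apply: le_lt_trans Boo; apply: le_trans (caratheodory_lime_le mE tE B).
  by rewrite leeDl // lebesgue_outer_ge0.
have /fine_cvgP[fs /cvgrPdist_lt/(_ _ e0)[N _ NP]] :=
  nneseries_tail_cvg sB (fun k _ => lebesgue_outer_ge0 _).
case: fs => N' _ N'P; exists (maxn N N').
rewrite setI_bigcupr.
apply: le_lt_trans (outer_measure_sigma_subadditive_tail mu _ _) _.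
have := NP (maxn N N') (leq_maxl _ _); have := N'P (maxn N N') (leq_maxr _ _).
rewrite /= sub0r normrN => /fineK <-; rewrite lte_fin; apply: le_lt_trans.
exact: ler_norm.
Qed.

End OuterMeasure.

Section Lipschitz.
Context {R : realType} {n : nat}.
Local Notation mu := (@lebesgue_outer R n).
Local Open Scope ereal_scope.

Lemma lebesgue_outer_small (A : set 'rV[R]_n) (e : R) : (0 <= e)%R ->
  (forall x y, A x -> A y -> `|x - y| <= e)%R -> mu A <= ((2 * e) ^+ n)%:E.
Proof.
move=> e0 Ae; have [[p Ap]|A0] := pselect (exists p, A p); last first.
  have -> : A = set0 by rewrite -subset0 => x Ax; apply: A0; exists x.
  by rewrite lebesgue_outer0 lee_fin exprn_ge0 ?mulr_ge0.
pose c : 'rV[R]_n := const_mx e.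
apply: (@le_trans _ _ (mu (closed_box (p - c) (p + c)%R))).
  apply: le_lebesgue_outer => x Ax i; rewrite !mxE.
  have /rV_norm_le := Ae x p Ax Ap => /(_ e0 i); rewrite !mxE ler_norml; lra.
apply: le_trans (lebesgue_outer_box _) _ => [i|]; first by rewrite !mxE; lra.
have -> : ((2 * e) ^+ n = \prod_(i < n) (2 * e))%R by rewrite prodr_const card_ord.
by rewrite lee_fin ler_prod // => i _; rewrite !mxE; lra.
Qed.

(** The box is covered by at most [\prod_i (side i / d + 1)] cubes of side [d],
and the image of each lies in a cube of side [2 * L * d]. *)
Lemma lebesgue_outer_lipschitz_grid (g : 'rV[R]_n -> 'rV[R]_n) A (L d : R)
    (a b : 'rV[R]_n) :
  (0 <= L)%R -> (0 < d)%R -> (forall i, a 0 i <= b 0 i)%R ->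
  (forall x y, A x -> A y -> `|g x - g y| <= L * `|x - y|)%R ->
  mu (g @` (A `&` closed_box a b)) <=
    ((2 * L) ^+ n * \prod_i (b 0 i - a 0 i + d))%:E.
Proof.
move=> L0 d0 ab gL; pose m i := (Num.truncn ((b 0%R i - a 0%R i) / d)).+1.
pose M := (\sum_i m i)%N; have mM i : (m i <= M)%N by rewrite /M (bigD1 i) //= leq_addr.
pose cell (f : {ffun 'I_n -> 'I_M}) := [set x : 'rV[R]_n |
  forall i, a 0 i + (f i)%:R * d <= x 0 i <= a 0 i + (f i)%:R * d + d]%R.
pose Q i := [pred j : 'I_M | (j < m i)%N].
pose S f := g @` (A `&` cell f).
apply: (@le_trans _ _ (mu (\big[setU/set0]_(f <- index_enum _ | f \in family Q) S f))).
  apply: le_lebesgue_outer => _ [x [Ax abx] <-].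
  have xa i : (0 <= (x 0 i - a 0 i) / d)%R.
    by rewrite divr_ge0 ?(ltW d0) // subr_ge0; case/andP: (abx i).
  have hm i : (Num.truncn ((x 0 i - a 0 i) / d)%R < m i)%N.
    rewrite ltnS le_truncn // ler_pM2r ?invr_gt0 // lerD2r.
    by case/andP: (abx i).
  pose f := [ffun i => Ordinal (leq_trans (hm i) (mM i))].
  rewrite (bigD1 f) /=; last by apply/familyP => i; rewrite ffunE inE /= hm.
  left; exists x => //; split=> // i; rewrite ffunE /=.
  by have /andP[] := truncn_itv (xa i); rewrite ler_pdivlMr // ltr_pdivrMr // mulrSr; lra.
apply: le_trans (lebesgue_outer_bigsetU _ _ _) _.
apply: (@le_trans _ _ (\sum_(f in family Q) (\prod_(i < n) (2 * (L * d)))%R%:E)).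
  apply: lee_sum => f _; rewrite prodr_const card_ord.
  apply: lebesgue_outer_small; first by rewrite mulr_ge0 // ltW.
  move=> _ _ [x [Ax fx] <-] [y [Ay fy] <-]; apply: le_trans (gL _ _ Ax Ay) _.
  rewrite ler_wpM2l //; apply/rV_norm_le => [|i]; first exact: ltW.
  by rewrite !mxE ler_norml; have := fx i; have := fy i; lra.
rewrite sumEFin lee_fin -(bigA_distr_big_dep Q (fun _ _ => 2 * (L * d))%R).
have -> : ((2 * L) ^+ n = \prod_(i < n) (2 * L))%R by rewrite prodr_const card_ord.
rewrite -big_split /=.
apply: ler_prod => i _; apply/andP; split.
  by apply: sumr_ge0 => j _; rewrite !mulr_ge0 // ltW.
rewrite -(big_ord_widen M (fun=> 2 * (L * d))%R (mM i)) sumr_const card_ord.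
rewrite -[leLHS]mulr_natl mulrCA -mulrA ler_pM2l // mulrCA ler_wpM2l //.
rewrite /m mulrSr mulrDl mul1r lerD2r -ler_pdivlMr //.
have xa : (0 <= (b 0 i - a 0 i) / d)%R by rewrite divr_ge0 ?(ltW d0) // subr_ge0.
by have /andP[] := truncn_itv xa.
Qed.

(** The mesh of the grid tends to [0]. *)
Lemma lebesgue_outer_lipschitz_box (g : 'rV[R]_n -> 'rV[R]_n) A (L : R)
    (a b : 'rV[R]_n) :
  (0 <= L)%R -> (forall i, a 0 i <= b 0 i)%R ->
  (forall x y, A x -> A y -> `|g x - g y| <= L * `|x - y|)%R ->
  mu (g @` (A `&` closed_box a b)) <= ((2 * L) ^+ n * \prod_i (b 0 i - a 0 i))%:E.
Proof.
move=> L0 ab gL; apply/lee_addgt0Pr => e e0.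
pose f (t : 'I_n -> R) := ((2 * L) ^+ n * \prod_i (b 0 i - a 0 i + t i))%R.
have pf : polyf f.
  apply: polyfM; first exact: polyf_cst.
  by apply: polyf_prod => i; apply: polyfD; [apply: polyf_cst | apply: polyf_var].
have [d d0 fd] := polyf_continuous (fun=> 0%R) pf e0.
apply: le_trans (lebesgue_outer_lipschitz_grid L0 d0 ab gL) _.
have /fd : forall i : 'I_n, (`|d - 0| <= d)%R by move=> i; rewrite subr0 gtr0_norm.
have -> : f (fun=> 0%R) = ((2 * L) ^+ n * \prod_i (b 0 i - a 0 i))%R.
  by rewrite /f; congr (_ * _)%R; apply: eq_bigr => i _; rewrite addr0.
by rewrite -EFinD lee_fin -/(f (fun=> d)) ltr_norml /f; lra.
Qed.

Lemma lebesgue_outer_lipschitz (g : 'rV[R]_n -> 'rV[R]_n) A (L : R) :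
  (0 < L)%R -> (forall x y, A x -> A y -> `|g x - g y| <= L * `|x - y|)%R ->
  mu (g @` A) <= ((2 * L) ^+ n)%:E * mu A.
Proof.
move=> L0 gL; have c0 : (0 < (2 * L) ^+ n)%R by rewrite exprn_gt0 // mulr_gt0.
rewrite -lee_pdivrMl //; apply: le_ereal_inf_tmp => _ [D [a [b [ab AD ->]]]].
rewrite lee_pdivrMl //.
pose S k := if k \in D then g @` (A `&` closed_box (a k) (b k)) else set0.
apply: (@le_trans _ _ (mu (\bigcup_k S k))).
  apply: le_lebesgue_outer => _ [x Ax <-]; have [k Dk xk] := AD x Ax.
  by exists k => //; rewrite /S mem_set //; exists x.
apply: le_trans (outer_measure_sigma_subadditive mu S) _.
rewrite -[D]set_mem_set -nneseries_esum => [|k _]; last exact: box_vol_ge0.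
rewrite -nneseriesZl => [|k _]; last exact: box_vol_ge0.
rewrite [leRHS]eseries_mkcond; apply: lee_nneseries => [k _ _|k _].
  exact: lebesgue_outer_ge0.
rewrite /S; case: ifP => kD; last by rewrite outer_measure0.
by apply: lebesgue_outer_lipschitz_box => //; apply: ltW.
Qed.

End Lipschitz.

Section BoxVolume.
Context {R : realType}.
Local Open Scope ereal_scope.
Local Notation leb := (@lebesgue_measure R).

(** Induction on the dimension: the slices of the covering boxes at a given first
coordinate cover the slice of the large box, and integrating this inequality
in the first coordinate gives the claim. *)
Lemma volume_le_cover n (lo hi : 'I_n -> R) (D : set nat) (a b : nat -> 'I_n -> R) :
  (forall i, lo i <= hi i)%R -> (forall k i, a k i <= b k i)%R ->
  (forall x, (forall i, lo i <= x i <= hi i)%R ->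
    exists2 k, D k & forall i, (a k i <= x i <= b k i)%R) ->
  (\prod_i (hi i - lo i))%:E <= \esum_(k in D) (\prod_i (b k i - a k i))%:E.
Proof.
have pos n' (c d : 'I_n' -> R) : (forall i, c i <= d i)%R -> (0 <= \prod_i (d i - c i))%R.
  by move=> cd; apply: prodr_ge0 => i _; rewrite subr_ge0.
elim: n => [|n IHn] in lo hi D a b *.
  move=> _ _ /(_ (fun=> 0%R))[|k Dk _]; first by case.
  rewrite big_ord0; apply: esum_ge; exists [set k].
    by split => //; move=> _ ->.
  by rewrite fsbig_set1 big_ord0.
move=> lohi ab cov.
pose v k := (\prod_i (b k (lift ord0 i) - a k (lift ord0 i)))%R.
pose v0 := (\prod_i (hi (lift ord0 i) - lo (lift ord0 i)))%R.
pose J : set R := `[lo ord0, hi ord0]%classic.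
pose phi k (x : R) : \bar R :=
  if k \in D then (v k)%:E * (\1_(`[a k ord0, b k ord0]%classic) x)%:E else 0.
have v_ge0 k : (0 <= v k)%R by apply: pos.
have mJ : measurable J by exact: measurable_itv.
have phi0 k x : 0 <= phi k x.
  by rewrite /phi; case: ifP => // _; rewrite mule_ge0 ?lee_fin.
have mphi k : measurable_fun J (phi k).
  rewrite /phi; case: (k \in D); last exact: measurable_cst.
  apply: measurable_funeM; apply/measurable_EFinP.
  exact: measurable_indic.
have slice x : J x -> v0%:E <= \sum_(k <oo) phi k x.
  move=> Jx; rewrite nneseries_esumT //.
  pose D' := D `&` [set k | a k ord0 <= x <= b k ord0]%R.
  apply: (@le_trans _ _ (\esum_(k in D') (v k)%:E)).
    apply: IHn => // y yP.
    pose z i := if unlift ord0 i is Some j then y j else x.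
    have [|k Dk kz] := cov z.
      move=> i; rewrite /z; case: unliftP => [j ->|->] //.
    exists k => [|i]; last by have := kz (lift ord0 i); rewrite /z liftK.
    by split => //=; have := kz ord0; rewrite /z unlift_none.
  rewrite esum_mkcond; apply: le_esum => k _; rewrite /phi /D' in_setI.
  case: (k \in D) => //=; case: ifP => kx; last by rewrite mule_ge0 ?lee_fin.
  rewrite indicE mem_set ?mule1 //=.
  by move: kx; rewrite inE /= in_itv.
have sJ : leb J = (hi ord0 - lo ord0)%:E.
  rewrite lebesgue_measure_itv /= lte_fin; case: ltP => // h.
  have /eqP -> : hi ord0 == lo ord0 by rewrite eq_le h lohi.
  by rewrite subrr.
rewrite big_ord_recl -/v0 mulrC EFinM -sJ -integral_cst //.
apply: (@le_trans _ _ (\int[leb]_(x in J) (\sum_(k <oo) phi k x))).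
  apply: ge0_le_integral => //.
  - by move=> x _; rewrite lee_fin pos.
  - have -> : (fun x => \sum_(k <oo) phi k x) = (fun x => \sum_(k <oo | k \in predT) phi k x).
      by apply/funext => x; apply: eq_eseriesl.
    by apply: ge0_emeasurable_sum => [k x _ _|k _]; [apply: phi0 | apply: mphi].
rewrite integral_nneseries // nneseries_esumT => [|k]; last exact: integral_ge0.
rewrite [leRHS]esum_mkcond; apply: le_esum => k _; rewrite /phi; case: (k \in D); last first.
  by rewrite integral0.
rewrite ge0_integralZl_EFin //; last first.
  by apply/measurable_EFinP; apply: measurable_indic.
rewrite integral_indic // big_ord_recl mulrC EFinM -/(v k).
apply: lee_wpmul2l; first by rewrite lee_fin.
apply: (@le_trans _ _ (leb `[a k ord0, b k ord0]%classic)).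
  by apply: le_measure; rewrite ?inE //; apply: measurableI.
rewrite lebesgue_measure_itv /= lte_fin; case: ltP => //.
by rewrite lee_fin subr_ge0.
Qed.

Lemma lebesgue_outer_box_gt0 n (a b : 'rV[R]_n) :
  (forall i, a 0 i < b 0 i)%R -> 0 < lebesgue_outer (closed_box a b).
Proof.
move=> ab; apply: (@lt_le_trans _ _ (\prod_i (b 0 i - a 0 i))%:E).
  by rewrite lte_fin prodr_gt0 // => i _; rewrite subr_gt0.
apply: le_ereal_inf_tmp => _ [D [c [d [cd AD ->]]]].
apply: (@volume_le_cover n (a 0%R) (b 0%R) D (fun k => c k 0%R) (fun k => d k 0%R)) => [i|//|x xab].
  exact: ltW.
have [|k Dk kx] := AD (\row_i x i); first by move=> i; rewrite mxE.
by exists k => // i; have := kx i; rewrite mxE.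
Qed.

End BoxVolume.

(** An expanding map has a Lipschitz inverse on its image. *)
Lemma lebesgue_outer_expanding (R : realType) n (F : 'rV[R]_n -> 'rV[R]_n) A (K : R) :
  (0 < K)%R -> (forall x y, A x -> A y -> `|x - y| <= K * `|F x - F y|)%R ->
  (lebesgue_outer A <= ((2 * K) ^+ n)%:E * lebesgue_outer (F @` A))%E.
Proof.
move=> K0 FK; pose g z := xget 0 (A `&` F @^-1` [set z]).
have gK x : A x -> g (F x) = x.
  move=> Ax; rewrite /g; case: xgetP => [y _ [Ay Fy]|/(_ x)[]//].
  have := FK _ _ Ay Ax; rewrite Fy subrr normr0 mulr0 normr_le0 subr_eq0.
  by move/eqP.
have {1}-> : A = g @` (F @` A).
  apply/seteqP; split => [x Ax|_ [_ [x Ax <-] <-]]; last by rewrite gK.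
  by exists (F x); [exists x | rewrite gK].
apply: lebesgue_outer_lipschitz => // _ _ [x Ax <-] [y Ay <-].
by rewrite !gK //; apply: FK.
Qed.

(** * Vector-valued polynomial functions *)

Section Coords.
Context {R : realType} {V : vectType R}.
Local Notation n := (\dim {:V}).
Local Notation coords := (@coords R V).

Definition of_coords (y : 'rV[R]_n) : V := passmx.vecof (vbasis {:V}) y.

Lemma coordsK : cancel coords of_coords.
Proof. exact: passmx.rVofK (vbasisP _). Qed.
Lemma of_coordsK : cancel of_coords coords.
Proof. exact: passmx.vecofK (vbasisP _). Qed.
HB.instance Definition _ := GRing.isSemilinear.Build R V 'rV[R]_n _ coords
  (GRing.semilinear_linear (passmx.rVof_linear (vbasis {:V}))).

Lemma coordsD x y : coords (x + y) = coords x + coords y.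
Proof. exact: linearD. Qed.
Lemma coordsZ a x : coords (a *: x) = a *: coords x.
Proof. exact: linearZ. Qed.
Lemma coordsN x : coords (- x) = - coords x.
Proof. exact: linearN. Qed.
Lemma coords0 : coords 0 = 0.
Proof. exact: linear0. Qed.
Lemma coords_sum (T : Type) (r : seq T) (P : pred T) (F : T -> V) :
  coords (\sum_(i <- r | P i) F i) = \sum_(i <- r | P i) coords (F i).
Proof. exact: linear_sum. Qed.
Lemma coords_inj : injective coords.
Proof. exact: can_inj coordsK. Qed.

Lemma coords_expand x : x = \sum_i coords x 0 i *: (vbasis {:V})`_i.
Proof. by rewrite -[LHS]coordsK. Qed.

Implicit Types I J : finType.

Definition polyV I (f : (I -> R) -> V) := forall i, polyf (fun t => coords (f t) 0 i).

Lemma polyV_ext I (f g : (I -> R) -> V) : f =1 g -> polyV f -> polyV g.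
Proof. by move=> /funext ->. Qed.

Lemma polyV_cst I v : polyV (fun _ : I -> R => v).
Proof. by move=> i; apply: polyf_cst. Qed.

Lemma polyVD I (f g : (I -> R) -> V) : polyV f -> polyV g -> polyV (fun t => f t + g t).
Proof.
by move=> pf pg i; apply: polyf_ext (polyfD (pf i) (pg i)) => t; rewrite coordsD [RHS]mxE.
Qed.

Lemma polyVN I (f : (I -> R) -> V) : polyV f -> polyV (fun t => - f t).
Proof.
by move=> pf i; apply: polyf_ext (polyfN (pf i)) => t; rewrite coordsN [RHS]mxE.
Qed.

Lemma polyVB I (f g : (I -> R) -> V) : polyV f -> polyV g -> polyV (fun t => f t - g t).
Proof. by move=> pf pg; apply: polyVD pf _; apply: polyVN. Qed.

Lemma polyVZ I (f : (I -> R) -> R) (g : (I -> R) -> V) :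
  polyf f -> polyV g -> polyV (fun t => f t *: g t).
Proof.
by move=> pf pg i; apply: polyf_ext (polyfM pf (pg i)) => t; rewrite coordsZ [RHS]mxE.
Qed.

Lemma polyV_sum I (T : Type) (r : seq T) (P : pred T) (F : T -> (I -> R) -> V) :
  (forall a, polyV (F a)) -> polyV (fun t => \sum_(a <- r | P a) F a t).
Proof.
move=> pF i; apply: polyf_ext (polyf_sum r P (fun a => pF a i)) => t.
by rewrite coords_sum summxE.
Qed.

Lemma polyV_linear I (L : {linear V -> V}) (f : (I -> R) -> V) :
  polyV f -> polyV (fun t => L (f t)).
Proof.
move=> pf; pose e i := (vbasis {:V})`_i.
apply: (@polyV_ext _ (fun t => \sum_i coords (f t) 0 i *: L (e i))) => [t|].
  rewrite [in RHS](coords_expand (f t)) linear_sum; apply: eq_bigr => i _.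
  by rewrite linearZ.
by apply: polyV_sum => i; apply: polyVZ (pf i) _; apply: polyV_cst.
Qed.

Lemma polyV_of_coords I (f : 'I_n -> (I -> R) -> R) :
  (forall i, polyf (f i)) -> polyV (fun t => of_coords (\row_i f i t)).
Proof. by move=> pf i; apply: polyf_ext (pf i) => t; rewrite of_coordsK mxE. Qed.

Lemma polyV_homogeneous_linear (f : V -> V) :
  polyV (fun t : 'I_n -> R => f (of_coords (\row_i t i))) ->
  (forall x v, 0 < x -> f (x *: v) = x *: f v) -> linear f.
Proof.
move=> pf fZ.
have cE v : of_coords (\row_i coords v 0 i) = v.
  by rewrite -[RHS]coordsK; congr of_coords; apply/rowP => i; rewrite mxE.
have /choice[c cP] j : exists c : 'I_n -> R, forall v,
    coords (f v) 0 j = \sum_i c i * coords v 0 i.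
  have [x t x0|c cP] := polyf_homogeneous_linear (pf j).
    have -> : \row_i (x * t i) = x *: \row_i t i by apply/rowP => i; rewrite !mxE.
    rewrite -[of_coords (x *: _)]coordsK of_coordsK -[X in f X]coordsK.
    have -> : of_coords (x *: \row_i t i) = x *: of_coords (\row_i t i).
      by apply: coords_inj; rewrite coordsZ !of_coordsK.
    by rewrite coordsK fZ // coordsZ mxE.
  by exists c => v; rewrite -[in LHS](cE v) cP.
move=> a v w; apply: coords_inj; apply/rowP => j.
rewrite coordsD coordsZ [RHS]mxE [X in _ = X + _]mxE !cP mulr_sumr -big_split /=; apply: eq_bigr => i _.
by rewrite coordsD coordsZ !mxE; ring.
Qed.

End Coords.

Section GroupPoly.
Context {R : realType} {V : vectType R} (G : stratified_group V).
Local Notation br := (bracket G).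

Lemma polyV_bracket (I : finType) (f g : (I -> R) -> V) :
  polyV f -> polyV g -> polyV (fun t => br (f t) (g t)).
Proof.
move=> pf pg; pose e i := (vbasis {:V})`_i.
apply: (@polyV_ext _ _ _ (fun t =>
  \sum_i \sum_j (coords (f t) 0 i * coords (g t) 0 j) *: br (e i) (e j))) => [t|].
  rewrite [in RHS](coords_expand (f t)) linear_sumlz /=; apply: eq_bigr => i _.
  rewrite linearZl_LR [in RHS](coords_expand (g t)) linear_sumr scaler_sumr /=.
  by apply: eq_bigr => j _; rewrite linearZr_LR scalerA.
apply: polyV_sum => i; apply: polyV_sum => j; apply: polyVZ; last exact: polyV_cst.
exact: polyfM.
Qed.

End GroupPoly.

(** * The Baker-Campbell-Hausdorff product up to second order *)

Section BCH.
Context {R : realType} {V : vectType R} (G : stratified_group V).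
Local Notation br := (bracket G).

Lemma bracketC x y : br x y = - br y x.
Proof.
apply/eqP; rewrite -addr_eq0; have := @bracketxx _ _ G (x + y).
by rewrite linearDl linearDr /= linearDr /= !bracketxx add0r addr0 => ->.
Qed.

(** A word in two letters, [false] for the first factor and [true] for the second;
it depends only on the exponents, which separates the combinatorics of the
series from the vectors substituted into it. *)
Definition bch_letters s n (p : {ffun 'I_n -> 'I_s.+1 * 'I_s.+1}) : seq bool :=
  flatten [seq nseq (p i).1 false ++ nseq (p i).2 true | i <- enum 'I_n].

Definition nested_word (w : seq bool) (x y : V) : V :=
  nested_bracket br [seq if b then y else x | b <- w].

Lemma bch_word_letters s n (p : {ffun 'I_n -> 'I_s.+1 * 'I_s.+1}) x y :
  bch_word p x y = [seq if b then y else x | b <- bch_letters p] :> seq V.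
Proof.
rewrite /bch_word /bch_letters map_flatten -map_comp; congr flatten.
by apply: eq_map => i /=; rewrite map_cat !map_nseq.
Qed.

Lemma size_bch_letters s n (p : {ffun 'I_n -> 'I_s.+1 * 'I_s.+1}) :
  size (bch_letters p) = (\sum_i ((p i).1 + (p i).2))%N.
Proof. by rewrite -(size_bch_word p 0 (0 : V)) bch_word_letters size_map. Qed.

Lemma nested_word_cons b w x y : w != [::] ->
  nested_word (b :: w) x y = br (if b then y else x) (nested_word w x y).
Proof. by case: w. Qed.

Lemma nested_wordZ w a x y : nested_word w (a *: x) (a *: y) = a ^+ size w *: nested_word w x y.
Proof.
elim: w => [|b w IHw]; first by rewrite /nested_word /= scaler0.
have [->|w0] := eqVneq w [::]; first by case: b; rewrite /nested_word /= expr1.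
rewrite !nested_word_cons // IHw linearZr_LR /= exprSr -scalerA; congr (_ *: _).
by case: b; rewrite linearZl_LR.
Qed.

Lemma polyV_nested_word (I : finType) w (f g : (I -> R) -> V) :
  polyV f -> polyV g -> polyV (fun t => nested_word w (f t) (g t)).
Proof.
move=> pf pg; elim: w => [|b w IHw]; first exact: polyV_cst.
have [->|w0] := eqVneq w [::]; first by case: b.
apply: (@polyV_ext _ _ _ (fun t => br (if b then g t else f t) (nested_word w (f t) (g t)))) => [t|].
  by rewrite nested_word_cons.
by apply: polyV_bracket => //; case: b.
Qed.

Lemma nested_word_line w z a b : (1 < size w)%N -> nested_word w (a *: z) (b *: z) = 0.
Proof.
move=> w1; have [v|c E] := @nested_bracket_line _ _ G z [seq if c then b *: z else a *: z | c <- w].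
  by case/mapP=> -[] _ ->; [exists b | exists a].
by rewrite size_map /nested_word E => /(_ w1) ->; rewrite scale0r.
Qed.

Definition bch_coef s n (p : {ffun 'I_n -> 'I_s.+1 * 'I_s.+1}) : R :=
  (-1) ^+ n.-1 / (n * (\sum_i ((p i).1 + (p i).2))
             * \prod_i ((p i).1`! * (p i).2`!))%N%:R.

Definition bch_admissible s n (p : {ffun 'I_n -> 'I_s.+1 * 'I_s.+1}) :=
  [forall i, (0 < (p i).1 + (p i).2)%N].

Local Notation s := (step G).

Lemma gmul_sum x y : gmul G x y = \sum_(1 <= n < s.+1)
  \sum_(p : {ffun 'I_n -> 'I_s.+1 * 'I_s.+1} | bch_admissible p)
     bch_coef p *: nested_word (bch_letters p) x y.
Proof.
apply: eq_bigr => n _; apply: eq_bigr => p _.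
by rewrite bch_word_letters.
Qed.

Lemma polyV_gmul (I : finType) (f g : (I -> R) -> V) :
  polyV f -> polyV g -> polyV (fun t => gmul G (f t) (g t)).
Proof.
move=> pf pg; apply: (@polyV_ext _ _ _ (fun t => \sum_(1 <= n < s.+1)
  \sum_(p : {ffun 'I_n -> 'I_s.+1 * 'I_s.+1} | bch_admissible p)
     bch_coef p *: nested_word (bch_letters p) (f t) (g t))) => [t|].
  by rewrite gmul_sum.
apply: polyV_sum => n; apply: polyV_sum => p; apply: polyVZ; first exact: polyf_cst.
exact: polyV_nested_word.
Qed.

Lemma bch_admissible_size n (p : {ffun 'I_n -> 'I_s.+1 * 'I_s.+1}) :
  bch_admissible p -> (n <= size (bch_letters p))%N.
Proof.
move=> /forallP p0; rewrite size_bch_letters.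
apply: (@leq_trans (\sum_(i < n) 1)%N); first by rewrite sum1_card card_ord.
exact: leq_sum.
Qed.

Definition bch_homogeneous k x y := \sum_(1 <= n < s.+1)
  \sum_(p : {ffun 'I_n -> 'I_s.+1 * 'I_s.+1} | bch_admissible p && (size (bch_letters p) == k))
     bch_coef p *: nested_word (bch_letters p) x y.

Definition bch_remainder a x y := \sum_(1 <= n < s.+1)
  \sum_(p : {ffun 'I_n -> 'I_s.+1 * 'I_s.+1} | bch_admissible p && (2 < size (bch_letters p))%N)
     (bch_coef p * a ^+ (size (bch_letters p) - 3)) *: nested_word (bch_letters p) x y.

Lemma polyV_bch_remainder (I : finType) (a : (I -> R) -> R) (f g : (I -> R) -> V) :
  polyf a -> polyV f -> polyV g -> polyV (fun t => bch_remainder (a t) (f t) (g t)).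
Proof.
move=> pa pf pg; apply: polyV_sum => n; apply: polyV_sum => p; apply: polyVZ.
  by apply: polyfM; [apply: polyf_cst | apply: polyfX].
exact: polyV_nested_word.
Qed.

Lemma gmul_homogeneous_expansion a x y : gmul G (a *: x) (a *: y) =
  a *: bch_homogeneous 1 x y + a ^+ 2 *: bch_homogeneous 2 x y
    + a ^+ 3 *: bch_remainder a x y.
Proof.
rewrite gmul_sum /bch_homogeneous /bch_remainder !scaler_sumr -!big_split /=.
apply: eq_big_nat => n /andP[n0 _].
rewrite (bigID (fun p => size (bch_letters p) == 1%N)) /= -addrA; congr (_ + _).
  rewrite scaler_sumr; apply: eq_bigr => p /andP[_ /eqP p1].
  by rewrite nested_wordZ p1 expr1 !scalerA mulrC.
rewrite (bigID (fun p => size (bch_letters p) == 2%N)) /=; congr (_ + _).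
  rewrite scaler_sumr; apply: eq_big => [p|p /andP[_ /eqP p2]].
    by case: eqP => [->|//]; rewrite ?andbF ?andbT.
  by rewrite nested_wordZ p2 !scalerA mulrC.
rewrite scaler_sumr; apply: eq_big => [p|p /andP[/andP[pa p1] p2]].
  case: (boolP (bch_admissible p)) => //= /bch_admissible_size pn.
  by case: (size _) (leq_trans n0 pn) => [|[|[|k]]].
have p3 : (2 < size (bch_letters p))%N.
  by move: p1 p2 (leq_trans n0 (bch_admissible_size pa)); case: (size _) => [|[|[|k]]].
rewrite nested_wordZ !scalerA -{1}(subnKC p3) exprD; congr (_ *: _).
by rewrite mulrCA.
Qed.

(** Words of length one are additive in the pair of factors; with one factor equal
to [0] all longer words vanish, and the product is the other factor. *)
Lemma bch_homogeneous1 x y : bch_homogeneous 1 x y = x + y.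
Proof.
have split1 : bch_homogeneous 1 x y = bch_homogeneous 1 x 0 + bch_homogeneous 1 0 y.
  rewrite -big_split; apply: eq_bigr => n _; rewrite -big_split /=.
  apply: eq_bigr => p /andP[_ p1]; rewrite -scalerDr; congr (_ *: _).
  by case: (bch_letters p) p1 => [|b [|//]] // _; case: b; rewrite /nested_word /= ?addr0 ?add0r.
have line0 k (a b : R) z : (1 < k)%N -> bch_homogeneous k (a *: z) (b *: z) = 0.
  move=> k1; rewrite /bch_homogeneous big1 // => n _; rewrite big1 // => p /andP[_ /eqP pk].
  by rewrite nested_word_line ?scaler0 // pk.
have rem0 (a b : R) z : bch_remainder 1 (a *: z) (b *: z) = 0.
  rewrite /bch_remainder big1 // => n _; rewrite big1 // => p /andP[_ p3].
  by rewrite nested_word_line ?scaler0 // (ltn_trans _ p3).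
have lin (a b : R) z : bch_homogeneous 1 (a *: z) (b *: z) = (a + b) *: z.
  have := gmul_homogeneous_expansion 1 (a *: z) (b *: z).
  by rewrite (line0 2%N) // rem0 !scaler0 !addr0 !scale1r gmul_line.
rewrite split1; have := lin 1 0 x; have := lin 0 1 y.
by rewrite !scale0r !scale1r addr0 add0r !scale1r => -> ->.
Qed.

(** Only the word [xy] with a single block contributes: blocks [xx] and [yy] have
zero bracket, and the two-block words cancel in pairs. *)
Lemma bch_homogeneous2 x y : bch_homogeneous 2 x y = 2^-1 *: br x y.
Proof.
have s1 := step_gt0 G.
rewrite /bch_homogeneous big_ltn // [X in _ + X]big_nat_cond [X in _ + X]big1 ?addr0; last first.
  move=> n /andP[/andP[n2 _] _].
  have [n3|n3] := ltnP 2 n.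
    rewrite big1 // => p /andP[/bch_admissible_size pn /eqP p2].
    by move: (leq_trans n3 pn); rewrite p2.
  have {n2 n3} -> : n = 2%N by apply/eqP; rewrite eqn_leq n3 n2.
  (* exchanging the two blocks keeps the coefficient and reverses the bracket *)
  pose h (p : {ffun 'I_2 -> 'I_s.+1 * 'I_s.+1}) := [ffun i => p (rev_ord i)].
  have hK : involutive h by move=> p; apply/ffunP => i; rewrite !ffunE rev_ordK.
  set S := LHS; suff : S = - S.
    by move/eqP; rewrite -addr_eq0 -mulr2n -scaler_nat scaler_eq0 pnatr_eq0 => /eqP.
  rewrite {1}/S (reindex_inj (inv_inj hK)) /S -sumrN; apply: eq_big => [p|p].
    congr (_ && _).
      apply/forallP/forallP => /= P i; have := P (rev_ord i); rewrite ffunE ?rev_ordK //.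
    rewrite !size_bch_letters [in LHS](reindex_inj rev_ord_inj) /=.
    by congr (_ == _); apply: eq_bigr => i _; rewrite ffunE rev_ordK.
  case/andP=> /forallP hp; rewrite -scalerN.
  have -> : bch_coef (h p) = bch_coef p.
    rewrite /bch_coef; congr (_ / (_ * _ * _)%N%:R);
      by rewrite [in LHS](reindex_inj rev_ord_inj) /=; apply: eq_bigr => i _; rewrite ffunE rev_ordK.
  have enum2 : enum 'I_2 = [:: ord0; ord_max].
    by apply: (inj_map val_inj); rewrite val_enum_ord.
  rewrite /bch_letters enum2 /= !cats0 !ffunE.
  have -> : rev_ord (ord0 : 'I_2) = ord_max by apply: val_inj.
  have -> : rev_ord (ord_max : 'I_2) = ord0 by apply: val_inj.
  have := hp ord0; have := hp ord_max; rewrite !ffunE.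
  have -> : rev_ord (ord0 : 'I_2) = ord_max by apply: val_inj.
  have -> : rev_ord (ord_max : 'I_2) = ord0 by apply: val_inj.
  move: (p ord0) (p ord_max) => [i j] [k l] /= ij kl hs.
  have {hs} hs : (i + j + (k + l) == 2)%N.
    by move: hs; rewrite !size_cat !size_nseq addnC.
  have word1 (a b : 'I_s.+1) : (0 < a + b)%N -> (a + b <= 1)%N ->
      exists c, nseq a false ++ nseq b true = [:: c].
    by case: a b => [[|[|a]] ?] [[|[|b]] ?] //= _ _; [exists true | exists false].
  have ij1 : (i + j <= 1)%N by rewrite -ltnS -(eqP hs) -[X in (X < _)%N]addn0 ltn_add2l.
  have kl1 : (k + l <= 1)%N by rewrite -ltnS -(eqP hs) -[X in (X < _)%N]add0n ltn_add2r.
  have [c ->] := word1 i j ij ij1; have [d ->] := word1 k l kl kl1.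
  by congr (_ *: _); rewrite /nested_word /= bracketC.
have enum1 : enum 'I_1 = [:: ord0].
  by apply: (inj_map val_inj); rewrite val_enum_ord.
pose p11 : {ffun 'I_1 -> 'I_s.+1 * 'I_s.+1} := [ffun=> (inord 1, inord 1)].
have i1 : (inord 1 : 'I_s.+1) = 1%N :> nat by rewrite inordK.
have w11 : bch_letters p11 = [:: false; true].
  by rewrite /bch_letters enum1 /= ffunE /= i1.
rewrite (bigD1 p11) /=; last first.
  by rewrite w11 eqxx andbT; apply/forallP => i; rewrite ffunE /= i1.
rewrite [X in _ + X]big1 ?addr0 => [|p /andP[/andP[_ ps] p11N]].
  rewrite w11 /nested_word /= /bch_coef !big_ord1 !ffunE /= i1 /=.
  by rewrite expr0 !muln1 div1r.
suff -> : nested_word (bch_letters p) x y = 0 by rewrite scaler0.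
move: ps; rewrite /bch_letters enum1 /= cats0.
case E : (p ord0) => [[i hi] [j hj]] /=; rewrite size_cat !size_nseq.
case: i hi E => [|[|[|i]]] hi E; case: j hj E => [|[|[|j]]] hj E // _; rewrite /nested_word /=.
- by rewrite bracketxx.
- case/eqP: p11N; apply/ffunP => k; rewrite ffunE [k]ord1 E.
  by congr pair; apply: val_inj; rewrite /= i1.
- by rewrite bracketxx.
Qed.

Lemma gmul_expansion a x y : gmul G (a *: x) (a *: y) =
  a *: (x + y) + (a ^+ 2 / 2) *: br x y + a ^+ 3 *: bch_remainder a x y.
Proof.
by rewrite gmul_homogeneous_expansion bch_homogeneous1 bch_homogeneous2 scalerA.
Qed.

End BCH.

(** * Conjugations *)

Section Conjugation.
Context {R : realType} {V : vectType R} (G : stratified_group V).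
Local Notation br := (bracket G).
Local Notation n := (\dim {:V}).
Local Notation "x ** y" := (gmul G x y) (at level 40, left associativity).

Lemma gmulA : associative (gmul G).
Proof. exact: bch_assoc. Qed.

Lemma gmulNg x : (- x) ** x = 0.
Proof. exact: (gmulVg G x). Qed.
Lemma gmulgN x : x ** (- x) = 0.
Proof. exact: (gmulgV G x). Qed.
Lemma gmulKN x y : (- x) ** (x ** y) = y.
Proof. by rewrite gmulA gmulNg gmul0g. Qed.
Lemma gmulNK x y : x ** ((- x) ** y) = y.
Proof. by rewrite gmulA gmulgN gmul0g. Qed.
Lemma gmulKNr x y : (y ** x) ** (- x) = y.
Proof. by rewrite -gmulA gmulgN gmulg0. Qed.
Lemma gmulNKr x y : (y ** (- x)) ** x = y.
Proof. by rewrite -gmulA gmulNg gmulg0. Qed.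
Lemma gmul_inj x : injective (gmul G x).
Proof. exact: can_inj (gmulKN x). Qed.
Lemma gmul_opp x y : - (x ** y) = (- y) ** (- x).
Proof.
by apply: (@gmul_inj (x ** y)); rewrite gmulgN gmulA gmulKNr gmulgN.
Qed.

Definition gconj y x : V := (- y) ** x ** y.

Lemma gconj_comp y z x : gconj (y ** z) x = gconj z (gconj y x).
Proof. by rewrite /gconj gmul_opp !gmulA. Qed.

Lemma gconjM y x z : gconj y (x ** z) = gconj y x ** gconj y z.
Proof. by rewrite /gconj !gmulA gmulKNr. Qed.

Lemma gconj0 x : gconj 0 x = x.
Proof. by rewrite /gconj oppr0 gmul0g gmulg0. Qed.

Lemma gconjK y : cancel (gconj (- y)) (gconj y).
Proof. by move=> x; rewrite -gconj_comp gmulNg gconj0. Qed.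

Lemma polyV_gconj (I : finType) (f g : (I -> R) -> V) :
  polyV f -> polyV g -> polyV (fun t => gconj (f t) (g t)).
Proof. by move=> pf pg; apply: polyV_gmul => //; apply: polyV_gmul => //; apply: polyVN. Qed.

Lemma gconjMn y x m : gconj y (m%:R *: x) = m%:R *: gconj y x.
Proof.
elim: m => [|m IHm]; first by rewrite !scale0r /gconj gmulg0 gmulNg.
by rewrite mulrSr -!(gmul_line G) gconjM IHm !scale1r.
Qed.

(** A polynomial one-parameter subgroup is linear: it is so at the integers. *)
Lemma gconjZ y a x : gconj y (a *: x) = a *: gconj y x.
Proof.
apply: coords_inj; apply/rowP => i; apply/eqP; rewrite -subr_eq0.
pose f (t : unit -> R) := coords (gconj y (t tt *: x)) 0 i - coords (t tt *: gconj y x) 0 i.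
have pf : polyf f.
  have pa (z : V) : polyV (fun t : unit -> R => t tt *: z).
    by apply: polyVZ; [apply: polyf_var | apply: polyV_cst].
  have pc : polyV (fun t : unit -> R => gconj y (t tt *: x)).
    by apply: polyV_gconj; [apply: polyV_cst | apply: pa].
  exact: polyfB (pc i) (pa (gconj y x) i).
have [p pP] := polyf_line (fun=> 0) (fun=> 1) pf.
have E b : p.[b] = coords (gconj y (b *: x)) 0 i - coords (b *: gconj y x) 0 i.
  by rewrite -pP /f add0r mulr1.
rewrite -E; suff -> : p = 0 by rewrite horner0.
apply/eqP/negPn/negP => p0.
have : (size [seq m%:R : R | m <- iota 0 (size p)] < size p)%N.
  apply: max_poly_roots => //.
    by apply/allP => _ /mapP[m _ ->]; rewrite /root E gconjMn subrr.
  by rewrite map_inj_uniq ?iota_uniq // => m k /eqP; rewrite eqr_nat => /eqP.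
by rewrite size_map size_iota ltnn.
Qed.

Lemma polyV_coords_var : polyV (fun t : 'I_n -> R => of_coords (\row_i t i) : V).
Proof. by apply: polyV_of_coords => i; apply: polyf_var. Qed.

(** A polynomial map that is homogeneous of degree one is linear. *)
Lemma gconj_linear y : linear (gconj y).
Proof.
apply: polyV_homogeneous_linear; last by move=> *; apply: gconjZ.
by apply: polyV_gconj; [apply: polyV_cst | apply: polyV_coords_var].
Qed.

HB.instance Definition _ y := GRing.isSemilinear.Build R V V _ (gconj y)
  (GRing.semilinear_linear (gconj_linear y)).

(** Both products are expanded to second order on the vectors scaled by [a]; as
the conjugation is linear in [w], one factor [a] can be divided out, which
leaves an error of order [a ^+ 2]. *)
Lemma gconj_expansion x w : exists2 r : (unit -> R) -> V, polyV r &
  forall a, 0 < a -> gconj (a *: x) w = w + a *: (br w x + a *: r (fun=> a)).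
Proof.
pose i1 a := bch_remainder G a w x.
pose v a := w + x + (a / 2) *: br w x + a ^+ 2 *: i1 a.
have vE a : a *: w ** (a *: x) = a *: v a.
  rewrite gmul_expansion /v !scalerDr !scalerA; congr (_ + _ + _).
    by congr (_ *: _); ring.
pose r a := (2^-1 *: br (- x) (2^-1 *: br w x + a *: i1 a)) + i1 a
   + bch_remainder G a (- x) (v a).
exists (fun t => r (t tt)) => [|a a0].
  have pa : polyf (fun t : unit -> R => t tt) by apply: polyf_var.
  have pi1 : polyV (fun t : unit -> R => i1 (t tt)).
    by apply: polyV_bch_remainder => //; apply: polyV_cst.
  have pv : polyV (fun t : unit -> R => v (t tt)).
    apply: polyVD; last by apply: polyVZ => //; apply: polyfX.
    apply: polyVD; first exact: polyV_cst.
    by apply: polyVZ; [apply: polyfM => //; apply: polyf_cst | apply: polyV_cst].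
  apply: polyVD; last by apply: polyV_bch_remainder => //; apply: polyV_cst.
  apply: polyVD => //; apply: polyVZ; first exact: polyf_cst.
  apply: polyV_bracket; first exact: polyV_cst.
  by apply: polyVD; [apply: polyV_cst | apply: polyVZ].
apply: (scalerI (lt0r_neq0 a0)); rewrite -gconjZ /gconj -gmulA vE.
rewrite -scalerN gmul_expansion.
have -> : br (- x) (v a) = br w x + a *: br (- x) (2^-1 *: br w x + a *: i1 a).
  rewrite /v -addrA linearDr /= -[(a / 2) *: _]scalerA [a ^+ 2]expr2 -scalerA.
  rewrite -scalerDr linearZr_LR /=; congr (_ + _).
  by rewrite linearDr linearNl /= linearNl /= bracketxx oppr0 addr0 [RHS]bracketC.
rewrite /r; set b := br w x; set c := br (- x) _; set d := bch_remainder _ _ _ _.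
rewrite /v -/b; set e := i1 a.
apply: coords_inj; rewrite !(coordsD, coordsZ, coordsN).
move: (coords x) (coords w) (coords b) (coords c) (coords d) (coords e) => X W B C D E.
by apply/rowP => i; rewrite !mxE; field.
Qed.

End Conjugation.

(** * Horizontal words span the Lie algebra *)

Section Subspaces.
Context {R : realType} {V : vectType R}.

Lemma max_dim_vspace (P : {vspace V} -> Prop) : (exists U, P U) ->
  exists2 U, P U & forall W, P W -> (\dim W <= \dim U)%N.
Proof.
move=> [U0 PU0]; pose Q d := `[< exists2 U, P U & \dim U = d >].
have exQ : exists d, Q d by exists (\dim U0); apply/asboolP; exists U0.
have leQ d : Q d -> (d <= \dim {:V})%N by move=> /asboolP[U _ <-]; apply: dimvS; apply: subvf.
have [d /asboolP[U PU Ud] dmax] := ex_maxnP exQ leQ.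
by exists U => // W PW; rewrite Ud dmax //; apply/asboolP; exists W.
Qed.

(** A subspace of maximal dimension among those contained in [S] absorbs every
vector of [S]. *)
Lemma vspace_of_closed (S : V -> Prop) : S 0 ->
  (forall a x y, S x -> S y -> S (a *: x + y)) ->
  exists K : {vspace V}, forall x, (x \in K) <-> S x.
Proof.
move=> S0 Slin.
have [|K KS Kmax] := @max_dim_vspace (fun U => forall x, x \in U -> S x).
  by exists 0%VS => x; rewrite memv0 => /eqP ->.
exists K => x; split => [/KS //|Sx].
have : (\dim (<[x]> + K) <= \dim K)%N.
  apply: Kmax => z /memv_addP[_ /vlineP[a ->] [y /KS Sy ->]].
  exact: Slin.
move=> h; have /eqP E : (K == <[x]> + K)%VS by rewrite eqEdim addvSr h.
by rewrite E; apply: subvP (addvSl _ _) _ (memv_line x).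
Qed.

End Subspaces.

Section Spanning.
Context {R : realType} {V : vectType R} (G : stratified_group V).
Local Notation br := (bracket G).
Local Notation n := (\dim {:V}).
Local Notation "x ** y" := (gmul G x y) (at level 40, left associativity).

Inductive horizontal_product : V -> Prop :=
| horizontal_product0 : horizontal_product 0
| horizontal_productS a x g : x \in layer G 1 -> horizontal_product g ->
    horizontal_product (a *: x ** g).

(** [U] is spanned by the left-translated partial derivatives, at the word [g],
of the product of the letters of that word with respect to their scalars. *)
Inductive tangent_space : V -> {vspace V} -> Prop :=
| tangent_space0 : tangent_space 0 0%VS
| tangent_spaceS a x g U : x \in layer G 1 -> tangent_space g U ->
    tangent_space (a *: x ** g) (<[gconj G g x]> + U)%VS.

(** The derivative at [a = 0] of [a |-> gconj (a *: x) w] is [br w x], and a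
subspace contains the limits of its elements. *)
Lemma ad_invariant (K : {vspace V}) x : (forall a w, w \in K -> gconj G (a *: x) w \in K) ->
  forall w, w \in K -> br w x \in K.
Proof.
move=> cK w wK; have [r pr rP] := gconj_expansion G x w.
have memE z : (z \in K) = (z - projv K z == 0).
  apply/idP/idP => [/projv_id ->|]; first by rewrite subrr.
  by rewrite subr_eq0 => /eqP ->; apply: memv_proj.
pose f (t : unit -> R) := br w x + t tt *: r t - projv K (br w x + t tt *: r t).
have pf : polyV f.
  have p1 : polyV (fun t : unit -> R => br w x + t tt *: r t).
    by apply: polyVD; [apply: polyV_cst | apply: polyVZ => //; apply: polyf_var].
  by apply: polyVB => //; apply: polyV_linear.
have f0 : f (fun=> 0) = 0.
  apply: coords_inj; apply/rowP => i.
  apply: (polyf_extend0 (b := fun=> 1) (pf i)) => a a0.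
  have -> : (fun _ : unit => a * 1) = (fun=> a) by apply/funext => ?; rewrite mulr1.
  suff -> : f (fun=> a) = 0 by rewrite coords0 mxE.
  apply/eqP; rewrite /f -memE.
  have := cK a w wK; rewrite rP // => H.
  have : a^-1 *: (w + a *: (br w x + a *: r (fun=> a)) - w) \in K.
    by apply: memvZ; apply: memvB.
  by rewrite addrC addKr scalerA mulVf ?scale1r // lt0r_neq0.
by rewrite memE -f0 /f scale0r addr0.
Qed.

(** By the Jacobi identity the elements whose bracket preserves [K] form a
subalgebra, which contains the generators; so [K] is an ideal, in particular a
subalgebra containing the generators. *)
Lemma ideal_layer1_full (K : {vspace V}) : (layer G 1 <= K)%VS ->
  (forall x w, x \in layer G 1 -> w \in K -> br w x \in K) -> K = fullv.
Proof.
move=> HK brK.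
have [||N NP] := @vspace_of_closed R V (fun z => forall w, w \in K -> br w z \in K).
- by move=> w _; rewrite linear0r mem0v.
- move=> a x y hx hy w wK; rewrite linearDr linearZr_LR /=.
  by rewrite memvD ?memvZ ?hx ?hy.
have Nfull : N = fullv.
  apply: (@layer1_generates _ _ G); first by apply/subvP => x x1; apply/NP => w; apply: brK.
  move=> x y /NP hx /NP hy; apply/NP => w wK.
  have := @jacobi _ _ G w x y.
  rewrite -addrA => /eqP; rewrite addr_eq0 => /eqP ->.
  have yw : br y w \in K by rewrite bracketC memvN; apply: hy.
  rewrite memvN; apply: memvD; last by rewrite bracketC memvN; apply/hy/hx.
  by rewrite bracketC memvN; apply: hx.
apply: (@layer1_generates _ _ G) => // x y xK yK.
by have /NP -> : y \in N by rewrite Nfull memvf.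
Qed.

(** Let [U] be of maximal dimension. Prepending a letter [x] to a word adds one
conjugate of [x] to its tangent space; by maximality these conjugates all lie
in [U]. The vectors whose conjugates by all the words ending with [g] lie in [U]
form a subspace that contains the first layer and is stable under conjugation. *)
Lemma tangent_space_full : exists g, tangent_space g fullv.
Proof.
have [|U [g gU] Umax] := @max_dim_vspace R V (fun U => exists g, tangent_space g U).
  by exists 0%VS, 0; constructor.
exists g; suff <- : U = fullv by [].
have step h : horizontal_product h -> tangent_space (h ** g) U.
  elim=> [|a x k x1 _ IHk]; first by rewrite gmul0g.
  have t1 := tangent_spaceS a x1 IHk.
  rewrite -gmulA; suff E : (<[gconj G (k ** g) x]> + U)%VS = U by rewrite E in t1.
  apply/esym/eqP; rewrite eqEdim addvSr /=; apply: Umax.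
  by exists (a *: x ** (k ** g)).
have inU h x : horizontal_product h -> x \in layer G 1 -> gconj G g (gconj G h x) \in U.
  move=> hh x1; rewrite -gconj_comp; have := step h hh => t1.
  have t2 := tangent_spaceS 0 x1 t1.
  have /eqP -> : (U == <[gconj G (h ** g) x]> + U)%VS.
    by rewrite eqEdim addvSr /=; apply: Umax; exists (0 *: x ** (h ** g)).
  by apply: subvP (addvSl _ _) _ (memv_line _).
have [||K KP] := @vspace_of_closed R V (fun w => forall h, horizontal_product h ->
    gconj G g (gconj G h w) \in U).
- by move=> h _; rewrite !linear0 mem0v.
- move=> a x y hx hy h hh; rewrite !linearP; apply: memvD; last exact: hy.
  by apply: memvZ; apply: hx.
have Kfull : K = fullv.
  apply: ideal_layer1_full => [|x w x1 wK].
    by apply/subvP => x x1; apply/KP => h hh; apply: inU.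
  apply: ad_invariant wK => a {}w /KP wK; apply/KP => h hh.
  by rewrite -[gconj G h _]gconj_comp; apply: wK; constructor.
apply/eqP; rewrite eqEsubv subvf /=; apply/subvP => v _.
have /KP/(_ _ horizontal_product0) : gconj G (- g) v \in K by rewrite Kfull memvf.
by rewrite gconj0 gconjK.
Qed.

End Spanning.

(** * Charts made of horizontal words *)

Section Words.
Context {R : realType} {V : vectType R} (G : stratified_group V).
Local Notation n := (\dim {:V}).
Local Notation "x ** y" := (gmul G x y) (at level 40, left associativity).

Definition word k (X : 'I_k -> V) (t : 'I_k -> R) : V :=
  \big[gmul G/0]_(j < k) (t j *: X j).

Definition shift_env k (t : 'I_k -> R) j a : 'I_k -> R := fun i => t i + a * (i == j)%:R.

(** The left translate to the origin of the partial derivative of [word X] with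
respect to its scalar [j], by [word_shift]. *)
Definition word_dir k (X : 'I_k -> V) j (t : 'I_k -> R) : V :=
  (- word X t) ** word X (shift_env t j 1).

Lemma wordS k (X : 'I_k.+1 -> V) t :
  word X t = t ord0 *: X ord0 ** word (X \o lift ord0) (t \o lift ord0).
Proof. by rewrite /word big_ord_recl. Qed.

Lemma word_zero k (X : 'I_k -> V) : word X (fun=> 0) = 0.
Proof.
rewrite /word; elim/big_ind : _ => // [x y -> ->|j _]; first by rewrite gmul0g.
by rewrite scale0r.
Qed.

Lemma polyV_word k (X : 'I_k -> V) (I : finType) (f : 'I_k -> (I -> R) -> R) :
  (forall j, polyf (f j)) -> polyV (fun t => word X (f^~ t)).
Proof.
elim: k => [|k IHk] in X f * => pf.
  by apply: polyV_ext (@polyV_cst R V I 0) => t; rewrite /word big_ord0.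
apply: (@polyV_ext _ _ _ (fun t => f ord0 t *: X ord0 **
    word (X \o lift ord0) (fun j => f (lift ord0 j) t))) => [t|]; first by rewrite wordS.
apply: polyV_gmul; first by apply: polyVZ => //; apply: polyV_cst.
exact: IHk.
Qed.

Lemma polyV_word_dir k (X : 'I_k -> V) j (I : finType) (f : 'I_k -> (I -> R) -> R) :
  (forall j, polyf (f j)) -> polyV (fun t => word_dir X j (f^~ t)).
Proof.
move=> pf; apply: polyV_gmul; first by apply: polyVN; apply: polyV_word.
apply: (@polyV_word _ X _ (fun i t => f i t + 1 * (i == j)%:R)) => i.
by apply: polyfD => //; apply: polyf_cst.
Qed.

Lemma shift_env0 k (t : 'I_k.+1 -> R) a :
  shift_env t ord0 a \o lift ord0 = t \o lift ord0.
Proof. by apply/funext => i; rewrite /shift_env /= mulr0 addr0. Qed.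

Lemma shift_envS k (t : 'I_k.+1 -> R) j a :
  shift_env t (lift ord0 j) a \o lift ord0 = shift_env (t \o lift ord0) j a.
Proof. by apply/funext => i; rewrite /shift_env /= (inj_eq (lift_inj (h:=ord0))). Qed.

Lemma word_dir0 k (X : 'I_k.+1 -> V) t :
  word_dir X ord0 t = gconj G (word (X \o lift ord0) (t \o lift ord0)) (X ord0).
Proof.
rewrite /word_dir !wordS shift_env0 /shift_env eqxx mulr1 gmul_opp /gconj.
set g := word _ _; rewrite -[(t ord0 + 1) *: _](gmul_line G) scale1r.
by rewrite -!gmulA gmulKN.
Qed.

Lemma word_dirS k (X : 'I_k.+1 -> V) j t :
  word_dir X (lift ord0 j) t = word_dir (X \o lift ord0) j (t \o lift ord0).
Proof.
rewrite /word_dir !wordS shift_envS gmul_opp /shift_env /= mulr0 addr0.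
by rewrite -!gmulA gmulKN.
Qed.

(** The change of the letter [j] is conjugated through the letters on its right,
and conjugation commutes with scaling. *)
Lemma word_shift k (X : 'I_k -> V) t j a :
  word X (shift_env t j a) = word X t ** (a *: word_dir X j t).
Proof.
elim: k => [|k IHk] in X t j *; first by case: j.
case: (unliftP ord0 j) => [i ->|->].
  by rewrite word_dirS !wordS shift_envS IHk {1}/shift_env /= mulr0 addr0 gmulA.
rewrite word_dir0 !wordS shift_env0 {1}/shift_env eqxx mulr1 -(gmul_line G) -gconjZ.
by rewrite /gconj -!gmulA gmulNK.
Qed.

Definition cons_env T k (a : T) (t : 'I_k -> T) : 'I_k.+1 -> T :=
  fun i => oapp t a (unlift ord0 i).

Lemma cons_env0 T k a (t : 'I_k -> T) : cons_env a t ord0 = a.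
Proof. by rewrite /cons_env unlift_none. Qed.

Lemma cons_envS T k a (t : 'I_k -> T) : cons_env a t \o lift ord0 = t.
Proof. by apply/funext => i; rewrite /cons_env /= liftK. Qed.

Lemma mul_word_cons k (X : 'I_k.+1 -> V) z a t :
  z ** (a *: X ord0) ** word (X \o lift ord0) t = z ** word X (cons_env a t).
Proof. by rewrite wordS cons_env0 cons_envS gmulA. Qed.

Lemma tangent_space_word g U : tangent_space G g U ->
  exists k (X : 'I_k -> V) t, [/\ forall j, X j \in layer G 1, word X t = g &
    (\sum_j <[word_dir X j t]>)%VS = U].
Proof.
elim=> [|a x h W x1 _ [k [X [t [X1 Xg XU]]]]].
  exists 0%N, (fun=> 0), (fun=> 0); split; first by case.
    by rewrite /word big_ord0.
  by rewrite big_ord0.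
exists k.+1, (cons_env x X), (cons_env a t); split.
- by move=> j; rewrite /cons_env; case: (unlift ord0 j) => //= i.
- by rewrite wordS !cons_env0 !cons_envS Xg.
- rewrite big_ord_recl word_dir0 !cons_envS cons_env0 Xg -XU; congr (_ + _)%VS.
  by apply: eq_bigr => j _; rewrite word_dirS !cons_envS.
Qed.

Definition chart_mx k (X : 'I_k -> V) (f : 'I_n -> 'I_k) (t : 'I_k -> R) : 'M[R]_n :=
  \matrix_i coords (word_dir X (f i) t).

Lemma polyf_det (I : finType) m (A : (I -> R) -> 'M[R]_m) :
  (forall i j, polyf (fun t => A t i j)) -> polyf (fun t => \det (A t)).
Proof.
move=> pA; apply: polyf_sum => s; apply: polyfM; first exact: polyf_cst.
by apply: polyf_prod => i; apply: pA.
Qed.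

(** Rows of full rank are selected from the matrix of all the partial derivatives. *)
Lemma exists_chart : exists k (X : 'I_k -> V) (f : 'I_n -> 'I_k) t,
  (forall j, X j \in layer G 1) /\ chart_mx X f t \in unitmx.
Proof.
have [g /tangent_space_word[k [X [t [X1 _ Xfull]]]]] := tangent_space_full G.
pose A : 'M[R]_(k, n) := \matrix_j coords (word_dir X j t).
have rA : row_full A.
  rewrite -sub1mx; apply/row_subP => i.
  have : of_coords (row i 1%:M) \in (\sum_j <[word_dir X j t]>)%VS by rewrite Xfull memvf.
  move=> /memv_sumP[v vP E].
  rewrite -[row i _]of_coordsK E linear_sum; apply: summx_sub => j _.
  have /vlineP[a ->] := vP j isT; rewrite linearZ; apply: scalemx_sub.
  by apply: (eq_row_sub j); rewrite rowK.
exists k, X, (fullrankfun rA), t; split => //.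
have -> : chart_mx X (fullrankfun rA) t = rowsub (fullrankfun rA) A.
  by apply/matrixP => i j; rewrite !mxE.
exact: fullrowsub_unit.
Qed.

Definition flip k (s : {ffun 'I_k -> bool}) (t : 'I_k -> R) : 'I_k -> R :=
  fun j => (-1) ^+ s j * t j.

Lemma norm_flip k (s : {ffun 'I_k -> bool}) t j : `|flip s t j| = `|t j|.
Proof. by rewrite /flip normrM normrX normrN1 expr1n mul1r. Qed.

Lemma flipK k (s : {ffun 'I_k -> bool}) t : flip s (flip s t) = t.
Proof. by apply/funext => j; rewrite /flip signrMK. Qed.

(** An invertible differential is a generic condition on the scalars, so it holds
near [0] for all choices of the signs at once. *)
Lemma exists_small_charts : exists k (X : 'I_k -> V) (f : 'I_n -> 'I_k),
  (forall j, X j \in layer G 1) /\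
  forall e, 0 < e -> exists2 t, forall j, `|t j| < e &
    forall s, chart_mx X f (flip s t) \in unitmx.
Proof.
have [k [X [f [t [X1 tU]]]]] := exists_chart.
exists k, X, f; split => // e e0.
have [s|s||t' t'e] := @polyf_common_nonroot R 'I_k _ (enum {ffun 'I_k -> bool})
    (fun s t' => \det (chart_mx X f (flip s t'))) e.
- apply: polyf_det => i j; apply: (@polyf_ext _ _ (fun t' => coords (word_dir X (f i) (flip s t')) 0 j)).
    by move=> t'; rewrite [RHS]mxE.
  apply: (@polyV_word_dir _ X (f i) _ (fun i t' => (-1) ^+ s i * t' i)) => l.
  by apply: polyfM; [apply: polyf_cst | apply: polyf_var].
- by exists (flip s t); rewrite flipK -unitfE -unitmxE.
- exact: e0.
move=> /allP nz; exists t' => // s.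
by rewrite unitmxE unitfE nz // mem_enum.
Qed.

Definition chart_env k (f : 'I_n -> 'I_k) (t : 'I_k -> R) (y : 'rV[R]_n) : 'I_k -> R :=
  fun j => t j + \sum_i y 0 i * (j == f i)%:R.

(** By [word_shift] the derivative of this map at [0] is [chart_mx X f t]. *)
Lemma word_chart k (X : 'I_k -> V) f t : chart_mx X f t \in unitmx ->
  let F y := coords ((- word X t) ** word X (chart_env f t y)) in
  exists d C, [/\ 0 < d, 0 < C,
    forall y z, `|y| <= d -> `|z| <= d -> `|y - z| <= C * `|F y - F z| &
    forall r, 0 < r <= d -> exists2 r', 0 < r' &
      forall v, `|v| < r' -> exists2 y, `|y| <= r & F y = v].
Proof.
move=> tU F.
pose g j (y : 'I_n -> R) := coords ((- word X t) ** word X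
  (fun l => t l + \sum_i y i * (l == f i)%:R)) 0 j.
have pg j : polyf (g j).
  have : polyV (fun y : 'I_n -> R => (- word X t) ** word X
      (fun l => t l + \sum_i y i * (l == f i)%:R)); last by apply.
  apply: polyV_gmul; first exact: polyV_cst.
  apply: (@polyV_word _ X _ (fun l (y : 'I_n -> R) => t l + \sum_i y i * (l == f i)%:R)) => l.
  apply: polyfD; first exact: polyf_cst.
  by apply: polyf_sum => i; apply: polyfM; [apply: polyf_var | apply: polyf_cst].
have gline i a : (fun l => t l + \sum_i' (a *+ (i' == i)) * (l == f i')%:R) = shift_env t (f i) a.
  apply/funext => l; rewrite /shift_env (bigD1 i) //= eqxx mulr1n big1 ?addr0 // => j /negbTE->.
  by rewrite mul0r.
have g0 j : g j (fun=> 0) = 0.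
  rewrite /g (_ : (fun l => _) = t); first by rewrite gmulNg coords0 mxE.
  by apply/funext => l; rewrite big1 ?addr0 // => i _; rewrite mul0r.
have gA i j a : g j (fun l => a *+ (l == i)) - g j (fun=> 0) = a * chart_mx X f t i j.
  rewrite g0 subr0 /g gline word_shift gmulKN coordsZ [LHS]mxE; congr (_ * _).
  by rewrite [RHS]mxE.
have FE (y : 'rV[R]_n) : \row_j g j (y 0) = F y by apply/rowP => j; rewrite mxE.
have F0 : \row_j g j ((0 : 'rV[R]_n) 0) = 0.
  apply/rowP => j; rewrite !mxE -[RHS](g0 j); congr (g j _).
  by apply/funext => i; rewrite mxE.
have [d [C [d0 C0 lip op]]] := polyf_local_inverse pg gA tU.
exists d, C; split => // [y z yd zd|r rd]; first by rewrite -!FE; apply: lip.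
have [r' r'0 r'P] := op r rd; exists r' => // v vr.
have [|y yr yv] := r'P v; first by rewrite F0 subr0.
by exists y => //; rewrite -FE.
Qed.

End Words.

(** * Continuity of the group law, and convexity along horizontal lines *)

Section Near.
Context {R : realType} {V : vectType R} (G : stratified_group V).
Local Notation n := (\dim {:V}).
Local Notation "x ** y" := (gmul G x y) (at level 40, left associativity).

Lemma polyV_continuous (I : finType) (f : (I -> R) -> V) s e : polyV f -> 0 < e ->
  exists2 d, 0 < d & forall t, (forall i, `|t i - s i| <= d) -> `|coords (f t) - coords (f s)| < e.
Proof.
move=> pf e0.
have /choice[d /all_and2[d0 dP]] : forall j, exists d, 0 < d /\
    forall t, (forall i, `|t i - s i| <= d) -> `|coords (f t) 0 j - coords (f s) 0 j| < e.
  by move=> j; have [d d0 dP] := polyf_continuous s (pf j) e0; exists d.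
pose D := \big[Num.min/1]_j d j.
have D0 : 0 < D by rewrite /D; elim/big_ind : _ => // x y x0 y0; rewrite lt_min x0.
exists D => // t tD; apply/rV_norm_lt => // j; rewrite rV_subE; apply: dP => i.
by apply: le_trans (tD i) _; rewrite /D bigmin_le_cond.
Qed.

Lemma polyV_lipschitz (I : finType) (f : (I -> R) -> V) B : polyV f ->
  exists2 C, 0 < C & forall t s e, 0 <= e -> (forall i, `|t i| <= B) ->
    (forall i, `|s i| <= B) -> (forall i, `|t i - s i| <= e) ->
    `|coords (f t) - coords (f s)| <= C * e.
Proof.
move=> pf.
have /choice[c /all_and2[c0 cP]] : forall j, exists c, 0 < c /\ forall t s e, 0 <= e ->
    (forall i, `|t i| <= B) -> (forall i, `|s i| <= B) -> (forall i, `|t i - s i| <= e) ->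
    `|coords (f t) 0 j - coords (f s) 0 j| <= c * e.
  by move=> j; have [c c0 cP] := polyf_lipschitz B (pf j); exists c.
have C0 : 0 <= \sum_j c j by apply: sumr_ge0 => j _; apply: ltW.
exists (1 + \sum_j c j) => [|t s e e0 tB sB te]; first by rewrite ltr_pwDl.
apply/rV_norm_le => [|j]; first by rewrite mulr_ge0 // addr_ge0.
rewrite rV_subE; apply: le_trans (cP j t s e e0 tB sB te) _; rewrite ler_wpM2r //.
rewrite (bigD1 j) //= addrCA lerDl addr_ge0 // sumr_ge0 // => i _.
exact: ltW.
Qed.

Lemma polyV_gmul_coords : exists2 f : ('I_n + 'I_n -> R) -> V, polyV f &
  forall z w, f (pair_env (coords z 0) (coords w 0)) = z ** w.
Proof.
exists (fun t => of_coords (\row_i t (inl i)) ** of_coords (\row_i t (inr i))) => [|z w].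
  apply: polyV_gmul; apply: (polyV_of_coords (f := fun i t => t _)) => i; exact: polyf_var.
by congr (_ ** _); rewrite -[RHS]coordsK; congr of_coords; apply/rowP => i; rewrite mxE.
Qed.

Lemma gmul_continuous x y e : 0 < e -> exists2 d, 0 < d &
  forall z w, `|coords z - coords x| <= d -> `|coords w - coords y| <= d ->
    `|coords (z ** w) - coords (x ** y)| < e.
Proof.
have [f pf env] := polyV_gmul_coords => e0.
have [d d0 dP] := polyV_continuous (pair_env (coords x 0) (coords y 0)) pf e0.
exists d => // z w zd wd; rewrite -!env; apply: dP => -[i|i] /=.
  by apply: le_trans zd; have := rV_coord_norm (coords z - coords x) i; rewrite rV_subE.
by apply: le_trans wd; have := rV_coord_norm (coords w - coords y) i; rewrite rV_subE.
Qed.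

Lemma gmul_lipschitz B : exists2 C, 0 < C &
  forall g p q, `|coords g| <= B -> `|coords p| <= B -> `|coords q| <= B ->
    `|coords (g ** p) - coords (g ** q)| <= C * `|coords p - coords q|.
Proof.
have [f pf env] := polyV_gmul_coords; have [C C0 CP] := polyV_lipschitz B pf.
exists C => // g p q gB pB qB; rewrite -!env; apply: CP => // -[i|i] /=;
  do ?by apply: le_trans (rV_coord_norm _ _) _.
- by rewrite subrr normr0.
- by have := rV_coord_norm (coords p - coords q) i; rewrite rV_subE.
Qed.

Lemma line_near x h e : 0 < e -> exists2 d, 0 < d &
  forall t, `|t| <= d -> `|coords (x ** (t *: h)) - coords x| < e.
Proof.
move=> e0; have [b b0 bP] := gmul_continuous x 0 e0.
exists (b / (`|coords h| + 1)) => [|t tb]; first by rewrite divr_gt0 // ltr_wpDl.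
have := bP x (t *: h); rewrite gmulg0; apply; first by rewrite subrr normr0 ltW.
rewrite coords0 subr0 coordsZ normrZ.
move: tb; rewrite ler_pdivlMr ?ltr_wpDl // => /(le_trans _); apply.
by rewrite ler_wpM2l // lerDl.
Qed.

Lemma word_continuous0 k (X : 'I_k -> V) e : 0 < e -> exists2 d, 0 < d &
  forall a, (forall j, `|a j| <= d) -> `|coords (word G X a)| < e.
Proof.
move=> e0.
have pw : polyV (fun a : 'I_k -> R => word G X a).
  by apply: (@polyV_word _ _ _ _ X _ (fun j a => a j)) => j; apply: polyf_var.
have [d d0 dP] := polyV_continuous (fun=> 0) pw e0.
exists d => // a ad; have := dP a; rewrite word_zero coords0 subr0; apply => j.
by rewrite subr0.
Qed.

Lemma translated_word_near k (X : 'I_k -> V) x e : 0 < e -> exists2 d, 0 < d &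
  forall z a, `|coords z - coords x| <= d -> (forall j, `|a j| <= d) ->
    `|coords (z ** word G X a) - coords x| < e.
Proof.
move=> e0; have [d d0 dP] := gmul_continuous x 0 e0.
have [d' d'0 d'P] := word_continuous0 X d0.
exists (Num.min d d') => [|z a zd ad]; first by rewrite lt_min d0.
rewrite -[X in _ - coords X](gmulg0 G); apply: dP.
  by apply: le_trans zd _; rewrite ge_min lexx.
rewrite coords0 subr0; apply/ltW/d'P => j.
by apply: le_trans (ad j) _; rewrite ge_min lexx orbT.
Qed.

End Near.

Section Convexity.
Context {R : realType} {V : vectType R} (G : stratified_group V).
Variables (Omega : set V) (u : V -> R).
Hypothesis u_convex : h_convex G Omega u.
Local Notation n := (\dim {:V}).
Local Notation H1 := (layer G 1).
Local Notation "x ** y" := (gmul G x y) (at level 40, left associativity).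

Lemma h_convex_segment x h l : h \in H1 ->
  (forall t, 0 <= t <= 1 -> Omega (x ** (t *: h))) -> 0 <= l <= 1 ->
  u (x ** (l *: h)) <= l * u (x ** h) + (1 - l) * u x.
Proof.
move=> h1 xO l01; have dE t : dilation G t h = t *: h by apply: dilation_layer1.
have E : gmul G (ginv x) (x ** h) = h by apply: gmulKN.
have Ox : Omega x by have := xO 0; rewrite scale0r gmulg0; apply; rewrite lexx ler01.
have Oxh : Omega (x ** h) by have := xO 1; rewrite scale1r; apply; rewrite lexx ler01.
have := @u_convex x (x ** h) Ox Oxh; rewrite E => /(_ h1).
rewrite -(dE l); apply => // _ [t /= t01 <-]; rewrite dE; apply: xO.
by move: t01; rewrite in_itv.
Qed.

Lemma h_convex_line x h a b l : h \in H1 -> a <= b ->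
  (forall t, a <= t <= b -> Omega (x ** (t *: h))) -> 0 <= l <= 1 ->
  u (x ** ((a + l * (b - a)) *: h)) <= l * u (x ** (b *: h)) + (1 - l) * u (x ** (a *: h)).
Proof.
move=> h1 ab xO l01.
have E t : (x ** (a *: h)) ** (t *: ((b - a) *: h)) = x ** ((a + t * (b - a)) *: h).
  by rewrite -gmulA scalerA gmul_line.
have := @h_convex_segment (x ** (a *: h)) ((b - a) *: h) l.
rewrite E -[(x ** _) ** ((b - a) *: h)]gmulA gmul_line addrCA subrr addr0; apply => //.
  exact: memvZ.
move=> t /andP[t0 t1]; rewrite E; apply: xO; rewrite lerDl mulr_ge0 ?subr_ge0 //=.
by rewrite -lerBrDl ler_piMl // subr_ge0.
Qed.

(** A point is the midpoint of the two points reached by its first letter and the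
opposite letter; repeat with the next letter at each of them. *)
Lemma sign_tree_bound k (X : 'I_k -> V) t z M : (forall j, X j \in H1) ->
  (forall a, (forall j, `|a j| <= `|t j|) -> Omega (z ** word G X a)) ->
  (forall s, u (z ** word G X (flip s t)) <= M) -> u z <= M.
Proof.
elim: k => [|k IHk] in X t z * => X1 zO leaf.
  have := leaf [ffun=> true]; rewrite /word big_ord0 gmulg0; apply.
have half (b : bool) : u (z ** (((-1) ^+ b * t ord0) *: X ord0)) <= M.
  apply: (IHk (X \o lift ord0) (t \o lift ord0)) => [j|a at'|s]; first exact: X1.
    rewrite mul_word_cons; apply: zO => j; case: (unliftP ord0 j) => [i ->|->].
      by rewrite /cons_env liftK /=; apply: at'.
    by rewrite cons_env0 normrM normrX normrN1 expr1n mul1r.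
  rewrite mul_word_cons; have := leaf [ffun i => oapp s b (unlift ord0 i)].
  congr (u (_ ** word G X _) <= M); apply/funext => j; rewrite /flip ffunE.
  by case: (unliftP ord0 j) => [i ->|->]; rewrite /cons_env ?liftK ?unlift_none.
have := half false; have := half true; rewrite expr1 expr0 mul1r mulN1r => hN hP.
have : u (z ** ((-1 + 2^-1 * (1 - -1)) *: (t ord0 *: X ord0))) <=
    2^-1 * u (z ** (1 *: (t ord0 *: X ord0))) + (1 - 2^-1) * u (z ** (-1 *: (t ord0 *: X ord0))).
  apply: h_convex_line; [by rewrite memvZ | by lra | | by lra].
  move=> c c1; rewrite scalerA -[z ** _](gmulg0 G) -(word_zero G (X \o lift ord0)).
  rewrite mul_word_cons; apply: zO => j.
  case: (unliftP ord0 j) => [i ->|->]; first by rewrite /cons_env liftK normr0.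
  by rewrite cons_env0 normrM ler_piMl // ler_norml.
have -> : -1 + 2^-1 * (1 - -1) = 0 :> R by field.
by rewrite scale0r gmulg0 scale1r scalerA mulN1r; lra.
Qed.

End Convexity.

(** * Local upper bounds *)

Section Exhaustion.
Context {R : realType} {V : vectType R}.
Variables (Omega : set V) (u : V -> R).
Local Notation n := (\dim {:V}).

Lemma vopen_ball x : vopen Omega -> Omega x ->
  exists2 r, 0 < r & forall y, `|coords y - coords x| < r -> Omega y.
Proof.
move=> oO Ox; have : nbhs (coords x) (coords @` Omega).
  by apply: open_nbhs_nbhs; split => //; exists x.
move=> /nbhs_ballP[r /= r0 rO]; exists r => // y yr.
have : (coords @` Omega) (coords y) by apply: rO; rewrite mx_norm_ball /ball_ /= distrC.
by case=> z Oz /coords_inj <-.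
Qed.

(** The domain is the disjoint union of the measurable slices [I k] of the values,
and a bounded piece of it has finite measure. *)
Lemma superlevel_small x r (e : R) : vmeasurable_fun Omega u ->
  (forall y, `|coords y - coords x| < r -> Omega y) -> 0 < e ->
  exists N : nat, (lebesgue_outer
    (coords @` [set y | (`|coords y - coords x| < r)%R /\ (N%:R < u y)%R]) < e%:E)%E.
Proof.
move=> mu_u rO e0.
have [r0|r0] := leP r 0.
  exists 0%N; rewrite (_ : [set y | _] = set0) ?image_set0 ?lebesgue_outer0 ?lte_fin //.
  rewrite -subset0 => y [yr _]; have := le_lt_trans (normr_ge0 _) yr.
  by rewrite ltNge r0.
pose I k := if k is k'.+1 then `]k'%:R : R, k'.+1%:R]%classic else `]-oo, 0 : R]%classic.
pose E k := coords @` (Omega `&` u @^-1` I k).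
pose B := coords @` [set y | `|coords y - coords x| < r].
have mE k : (@lebesgue_outer R n).-caratheodory (E k).
  by apply: mu_u; case: k => [|k] /=; apply: measurable_itv.
have Ile k a : I k a -> a <= k%:R.
  by case: k => [|k]; rewrite /I /= in_itv /= => // /andP[].
have Igt k a : I k.+1 a -> k%:R < a by rewrite /I /= in_itv /= => /andP[].
have tE : trivIset setT E.
  apply/trivIsetP => i j _ _; wlog ij : i j / (i < j)%N => [W|_].
    rewrite neq_ltn => /orP[ij|ij]; first by apply: W => //; rewrite neq_ltn ij.
    by rewrite setIC; apply: W => //; rewrite neq_ltn ij.
  case: j ij => // j; rewrite ltnS => ij.
  rewrite -subset0 => _ [[y [_ Iy] <-] [z [_ Iz] /coords_inj zy]].
  rewrite zy in Iz.
  by have := lt_le_trans (Igt _ _ Iz) (Ile _ _ Iy); rewrite ltr_nat ltnNge ij.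
have BE : B `<=` \bigcup_k E k.
  move=> _ [y yr <-]; have Oy := rO y yr.
  have exk : exists k, u y <= k%:R.
    exists (Num.truncn `|u y|).+1; apply: le_trans (ler_norm _) _.
    exact/ltW/truncnS_gt.
  have [k uk kmin] := ex_minnP exk; exists k => //; exists y => //; split => //.
  case: k uk kmin => [|k] uk kmin; rewrite /I /= in_itv //= uk andbT ltNge.
  by apply/negP => /kmin; rewrite ltnn.
have Boo : (lebesgue_outer B < +oo)%E.
  apply: (@le_lt_trans _ _ (lebesgue_outer
    (closed_box (coords x - const_mx r) (coords x + const_mx r)))).
    apply: le_lebesgue_outer => _ [y yr <-] i; rewrite /= in yr.
    have := le_lt_trans (rV_coord_norm (coords y - coords x) i) yr.
    by rewrite !mxE ltr_norml; lra.
  by apply: le_lt_trans (lebesgue_outer_box _) (ltry _) => i; rewrite !mxE; lra.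
have [N NP] := lebesgue_outer_exhaustion mE tE BE Boo e0.
exists N; apply: le_lt_trans NP; apply: le_lebesgue_outer => _ [y [yr Ny] <-].
split; first by exists y.
have [k _ Ek] := BE _ (imageP coords yr).
exists k => //= kN.
have [z [_ Iz] /coords_inj zy] := Ek.
by have := Ile _ _ Iz; rewrite zy => /(lt_le_trans Ny); rewrite ltr_nat ltnNge ltnW.
Qed.

End Exhaustion.

Section UpperBound.
Context {R : realType} {V : vectType R} (G : stratified_group V).
Variables (Omega : set V) (u : V -> R).
Hypothesis u_convex : h_convex G Omega u.
Hypothesis Omega_open : vopen Omega.
Hypothesis u_measurable : vmeasurable_fun Omega u.
Local Notation n := (\dim {:V}).
Local Notation H1 := (layer G 1).
Local Notation "x ** y" := (gmul G x y) (at level 40, left associativity).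

Definition flip_rV k (f : 'I_n -> 'I_k) (s : {ffun 'I_k -> bool}) (y : 'rV[R]_n) : 'rV[R]_n :=
  \row_i ((-1) ^+ s (f i) * y 0 i).

Lemma flip_chart_env k (f : 'I_n -> 'I_k) s t y :
  flip s (chart_env f t y) = chart_env f (flip s t) (flip_rV f s y).
Proof.
apply/funext => j; rewrite /flip /chart_env mulrDr mulr_sumr; congr (_ + _).
apply: eq_bigr => i _; rewrite mxE; case: eqP => [->|_]; last by rewrite !mulr0.
by rewrite mulrA.
Qed.

Lemma flip_rV_norm k (f : 'I_n -> 'I_k) s y z :
  `|flip_rV f s y - flip_rV f s z| = `|y - z|.
Proof.
have E i : `|(flip_rV f s y - flip_rV f s z) 0 i| = `|(y - z) 0 i|.
  by rewrite !mxE -mulrBr normrM normrX normrN1 expr1n mul1r.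
apply/eqP; rewrite eq_le; apply/andP; split; apply/rV_norm_le => // i.
  by rewrite E rV_coord_norm.
by rewrite -E rV_coord_norm.
Qed.

Lemma flip_rV0 k (f : 'I_n -> 'I_k) s : flip_rV f s 0 = 0.
Proof. by apply/rowP => i; rewrite !mxE mulr0. Qed.

Lemma chart_env_small k (f : 'I_n -> 'I_k) t y e : 0 <= e ->
  (forall j, `|t j| <= e) -> `|y| <= e / n.+1%:R ->
  forall j, `|chart_env f t y j| <= 2 * e.
Proof.
move=> e0 te ye j; rewrite /chart_env mulrDl mul1r (le_trans (ler_normD _ _)) // lerD //.
apply: le_trans (ler_norm_sum _ _ _) _.
apply: (@le_trans _ _ (\sum_(i < n) e / n.+1%:R)).
  apply: ler_sum => i _; rewrite normrM; apply: le_trans ye.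
  apply: le_trans (rV_coord_norm y i); rewrite ler_piMr // normr_nat.
  by case: (_ == _); rewrite ?ler01.
rewrite sumr_const card_ord -[leLHS]mulr_natl mulrCA ler_piMr //.
by rewrite ler_pdivrMr // mul1r ler_nat.
Qed.

(** All the points near [x] are centres of a sign tree whose leaves lie in a
sublevel set of nearly full measure: the scalars of the tree for which one of the
leaves falls outside form a set of small measure, because each leaf is a chart. *)
Lemma h_convex_bounded_above x : Omega x ->
  exists M d, 0 < d /\ forall z, `|coords z - coords x| <= d -> u z <= M.
Proof.
move=> Ox; have [r r0 rO] := vopen_ball Omega_open Ox.
have [k [X [f [X1 charts]]]] := exists_small_charts G.
have [d d0 dP] := translated_word_near G X x r0.
have e0 : 0 < d / 2 by rewrite divr_gt0.
have [t te tU] := charts _ e0.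
have /choice[c cP] s : exists c : R * R, [/\ 0 < c.1, 0 < c.2 &
    forall y z, `|y| <= c.1 -> `|z| <= c.1 -> `|y - z| <= c.2 *
      `|coords ((- word G X (flip s t)) ** word G X (chart_env f (flip s t) y)) -
        coords ((- word G X (flip s t)) ** word G X (chart_env f (flip s t) z))|].
  by have [c [C [c0 C0 lip _]]] := word_chart (tU s); exists (c, C).
pose eta := \big[Num.min/d / 2 / n.+1%:R]_s (c s).1.
have eta0 : 0 < eta.
  rewrite /eta; elim/big_ind : _ => [|y z y0 z0|s _]; first by rewrite divr_gt0.
    by rewrite lt_min y0.
  by have [] := cP s.
have eta_le s : eta <= (c s).1 by rewrite /eta bigmin_le_cond.
have eta_le' : eta <= d / 2 / n.+1%:R by rewrite /eta bigmin_le_id.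
pose B := `|coords x| + r.
have inB y : `|coords y - coords x| < r -> `|coords y| <= B.
  move=> yr; rewrite -[coords y](subrK (coords x)) (le_trans (ler_normD _ _)) //.
  by rewrite addrC lerD2l ltW.
have [L L0 LP] := gmul_lipschitz G B.
pose K := \sum_s (c s).2 * L + 1.
have cL0 s : 0 < (c s).2 * L by have [_ ? _] := cP s; rewrite mulr_gt0.
have K0 : 0 < K by rewrite ltr_pwDr // sumr_ge0 // => s _; rewrite ltW.
have Kge s : (c s).2 * L <= K.
  by rewrite /K (bigD1 s) //= -addrA lerDl addr_ge0 // sumr_ge0 // => i _; rewrite ltW.
pose Q : set 'rV[R]_n := closed_box (const_mx (- eta)) (const_mx eta).
have Q_norm y : Q y -> `|y| <= eta.
  by move=> Qy; apply/rV_norm_le => [|i]; [exact: ltW | have := Qy i; rewrite !mxE ler_norml].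
have Q0 : (0 < lebesgue_outer Q)%E.
  by apply: lebesgue_outer_box_gt0 => i; rewrite !mxE; lra.
have Qfin : lebesgue_outer Q \is a fin_num.
  rewrite ge0_fin_numE ?ltW //; apply: le_lt_trans (lebesgue_outer_box _) (ltry _) => i.
  by rewrite !mxE; lra.
pose q := fine (lebesgue_outer Q).
have q0 : 0 < q by rewrite fine_gt0 // Q0 -ge0_fin_numE ?ltW.
pose N2 := #|{: {ffun 'I_k -> bool}}|.
have N20 : 0 < N2%:R * (2 * K) ^+ n :> R.
  rewrite mulr_gt0 ?exprn_gt0 ?mulr_gt0 // ltr0n /N2.
  by apply/card_gt0P; exists [ffun=> true].
have eps0 : 0 < q / (N2%:R * (2 * K) ^+ n) by rewrite divr_gt0.
have [M MP] := superlevel_small u_measurable rO eps0.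
set A := _ @` _ in MP.
exists M%:R, d; split => // z zd.
pose leaf s y := z ** word G X (flip s (chart_env f t y)).
have env_small s y : Q y -> forall j, `|flip s (chart_env f t y) j| <= d.
  move=> Qy j; rewrite norm_flip.
  have -> : d = 2 * (d / 2) by rewrite mulrC divfK.
  apply: chart_env_small => [|i|]; [exact: ltW | exact: ltW |].
  exact: le_trans (Q_norm _ Qy) eta_le'.
pose bad s := [set y | Q y /\ M%:R < u (leaf s y)].
have bad_small s : (lebesgue_outer (bad s) <= ((2 * K) ^+ n)%:E * lebesgue_outer A)%E.
  apply: (@le_trans _ _ (((2 * K) ^+ n)%:E *
      lebesgue_outer ((fun y => coords (leaf s y)) @` bad s))%E).
    apply: lebesgue_outer_expanding => // y y' [Qy _] [Qy' _].
    pose g := z ** word G X (flip s t).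
    have gB : `|coords (- g)| <= B.
      rewrite coordsN normrN; apply/inB/dP => // j.
      rewrite norm_flip.
      by apply: le_trans (ltW (te j)) _; rewrite ler_pdivrMr // ler_pMr // ler1n.
    have leafB w : Q w -> `|coords (leaf s w)| <= B.
      by move=> Qw; apply/inB/dP => //; apply: env_small.
    rewrite -(flip_rV_norm f s y y') /=.
    have [_ c20 lip] := cP s.
    have fQ w : Q w -> `|flip_rV f s w| <= (c s).1.
      move=> Qw; apply: le_trans (eta_le s); rewrite -[flip_rV f s w]subr0.
      by rewrite -(flip_rV0 f s) flip_rV_norm subr0; apply: Q_norm.
    apply: le_trans (lip _ _ (fQ _ Qy) (fQ _ Qy')) _.
    have E w : (- word G X (flip s t)) ** word G X (chart_env f (flip s t) (flip_rV f s w)) =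
        (- g) ** leaf s w.
      by rewrite /leaf flip_chart_env gmul_opp -!gmulA gmulKN.
    rewrite !E; apply: (@le_trans _ _ ((c s).2 * (L * `|coords (leaf s y) - coords (leaf s y')|))).
      by rewrite ler_pM2l //; apply: LP => //; apply: leafB.
    by rewrite mulrA ler_wpM2r.
  apply: lee_wpmul2l; first by rewrite lee_fin exprn_ge0 // mulr_ge0 // ltW.
  apply: le_lebesgue_outer => _ [y [Qy My] <-]; exists (leaf s y) => //; split => //.
  by apply: dP => //; apply: env_small.
have [y Qy yP] : exists2 y, Q y & forall s, u (leaf s y) <= M%:R.
  apply: contrapT => no.
  have Qbad : Q `<=` \big[setU/set0]_(s <- enum {ffun 'I_k -> bool}) bad s.
    move=> y Qy; have [s Ms] : exists s, M%:R < u (leaf s y).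
      apply: contrapT => nos; apply: no; exists y => // s.
      by rewrite leNgt; apply/negP => Ms; apply: nos; exists s.
    by rewrite -bigcup_seq; exists s => //=; rewrite mem_enum.
  have : (lebesgue_outer Q < q%:E)%E.
    apply: le_lt_trans (le_lebesgue_outer Qbad) _.
    apply: le_lt_trans (lebesgue_outer_bigsetU _ _ _) _.
    apply: (@le_lt_trans _ _ (\sum_(s <- enum {ffun 'I_k -> bool})
        ((2 * K) ^+ n)%:E * lebesgue_outer A)%E); first exact: lee_sum.
    have Afin : lebesgue_outer A \is a fin_num.
      by rewrite ge0_fin_numE ?lebesgue_outer_ge0 // (lt_trans MP) // ltry.
    rewrite -(fineK Afin) -EFinM sumEFin lte_fin big_const_seq.
    rewrite count_predT -cardE iter_addr_0 -[ltLHS]mulr_natl mulrA -/N2.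
    rewrite mulrC -ltr_pdivlMr //.
    by rewrite -lte_fin fineK.
  by rewrite fineK // ltxx.
apply: (sign_tree_bound u_convex (t := chart_env f t y) X1) => [a at_le|s]; last exact: yP.
apply/rO/dP => // j; apply: le_trans (at_le j) _.
by have := env_small [ffun=> false] y Qy j; rewrite norm_flip.
Qed.

End UpperBound.

(** * Continuity of horizontally convex functions *)

Section Continuity.
Context {R : realType} {V : vectType R} (G : stratified_group V).
Variables (Omega : set V) (u : V -> R).
Hypothesis u_convex : h_convex G Omega u.
Hypothesis Omega_open : vopen Omega.
Hypothesis u_measurable : vmeasurable_fun Omega u.
Local Notation n := (\dim {:V}).
Local Notation H1 := (layer G 1).
Local Notation "x ** y" := (gmul G x y) (at level 40, left associativity).

(** The upper estimate is convexity between [z] and [z ** h], the lower one is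
convexity between [z ** (- 1 *: h)] and [z ** (l *: h)]. *)
Lemma h_convex_oscillation z h M l : h \in H1 -> 0 <= l <= 1 ->
  (forall t, `|t| <= 1 -> Omega (z ** (t *: h)) /\ u (z ** (t *: h)) <= M) ->
  `|u (z ** (l *: h)) - u z| <= l * (M - u z).
Proof.
move=> h1 /andP[l0 l1] zO.
have segO a b t : -1 <= a -> b <= 1 -> a <= t <= b -> Omega (z ** (t *: h)).
  by move=> a1 b1 /andP[at_ tb]; apply: (zO _ _).1; rewrite ler_norml; lra.
have M1 : u (z ** (1 *: h)) <= M by apply: (zO _ _).2; rewrite normr1.
have MN1 : u (z ** (-1 *: h)) <= M by apply: (zO _ _).2; rewrite normrN1.
have up : u (z ** ((0 + l * (1 - 0)) *: h)) <=
    l * u (z ** (1 *: h)) + (1 - l) * u (z ** (0 *: h)).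
  apply: (h_convex_line u_convex) => //; last by rewrite l0.
  by move=> t; apply: segO => //; lra.
rewrite add0r subr0 mulr1 scale0r gmulg0 in up.
have l1' : 0 < l + 1 by rewrite ltr_wpDl.
have down : u (z ** ((-1 + (l + 1)^-1 * (l - -1)) *: h)) <=
    (l + 1)^-1 * u (z ** (l *: h)) + (1 - (l + 1)^-1) * u (z ** (-1 *: h)).
  apply: (h_convex_line u_convex) => //; first by lra.
    by move=> t; apply: segO => //; lra.
  by rewrite invr_ge0 ltW //= invf_le1 // lerDr.
rewrite opprK mulVf ?lt0r_neq0 // addNr scale0r gmulg0 in down.
have : (l + 1) * u z <= u (z ** (l *: h)) + l * u (z ** (-1 *: h)).
  move: down; rewrite -(ler_pM2l l1') mulrDr !mulrA mulfV ?lt0r_neq0 // mul1r.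
  by rewrite mulrBr mulr1 mulfV ?lt0r_neq0 // addrK.
have := ler_wpM2l l0 M1; have := ler_wpM2l l0 MN1.
by rewrite ler_norml; lra.
Qed.

(** Each letter multiplies [M - u] by a factor between [1 - l] and [1 + l]. *)
Lemma h_convex_word_oscillation k (X : 'I_k -> V) a z M r l : (forall j, X j \in H1) ->
  0 < r -> 0 <= l <= 1 -> (forall j, `|a j| <= l * r) ->
  (forall b, (forall j, `|b j| <= r) -> Omega (z ** word G X b) /\ u (z ** word G X b) <= M) ->
  `|u (z ** word G X a) - u z| <= ((1 + l) ^+ k - 1) * (M - u z).
Proof.
move=> + r0 l01; elim: k => [|k IHk] in X a z * => X1 al zM.
  by rewrite /word big_ord0 gmulg0 subrr normr0 expr0 subrr mul0r.
have [l0 l1] := andP l01; have lr : l * r <= r by rewrite ler_piMl // ltW.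
have zM' c : `|c| <= r -> Omega (z ** (c *: X ord0)) /\ u (z ** (c *: X ord0)) <= M.
  move=> cr; rewrite -[z ** _](gmulg0 G) -(word_zero G (X \o lift ord0)) mul_word_cons; apply: zM => j.
  by case: (unliftP ord0 j) => [i ->|->]; rewrite /cons_env ?liftK ?unlift_none //= normr0 ltW.
have Mz : 0 <= M - u z.
  have [|_] := zM' 0; first by rewrite normr0 ltW.
  by rewrite scale0r gmulg0 subr_ge0.
have step1 : `|u (z ** (a ord0 *: X ord0)) - u z| <= l * (M - u z).
  have [l00|l00] := eqVneq l 0.
    have := al ord0; rewrite l00 mul0r normr_le0 => /eqP ->.
    by rewrite scale0r gmulg0 subrr normr0 mul0r.
  have l_gt0 : 0 < l by rewrite lt_neqAle eq_sym l00.
  have -> : a ord0 *: X ord0 = l *: ((a ord0 / l) *: X ord0).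
    by rewrite scalerA mulrCA mulfV // mulr1.
  apply: h_convex_oscillation => //; first exact: memvZ.
  move=> t t1; rewrite scalerA; apply: zM'.
  rewrite !normrM normfV (gtr0_norm l_gt0) mulrA ler_pdivrMr // mulrC [r * l]mulrC.
  by rewrite -[leRHS]mulr1 ler_pM.
have step2 := IHk (X \o lift ord0) (a \o lift ord0) (z ** (a ord0 *: X ord0)).
rewrite mul_word_cons in step2.
have aE : cons_env (a ord0) (a \o lift ord0) = a.
  by apply/funext => j; rewrite /cons_env; case: (unliftP ord0 j) => [i ->|->].
rewrite aE in step2.
have {step2} step2 : `|u (z ** word G X a) - u (z ** (a ord0 *: X ord0))| <=
    ((1 + l) ^+ k - 1) * (M - u (z ** (a ord0 *: X ord0))).
  apply: step2 => [j|j|b br]; [exact: X1 | exact: al |].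
  rewrite mul_word_cons; apply: zM => j.
  case: (unliftP ord0 j) => [i ->|->]; rewrite /cons_env ?liftK ?unlift_none //=.
  exact: le_trans (al ord0) lr.
have pk : 1 <= (1 + l) ^+ k by rewrite exprn_ege1 // lerDl.
set v := u (z ** (a ord0 *: X ord0)) in step1 step2 *.
have Mv : M - v <= (1 + l) * (M - u z) by move: step1; rewrite ler_norml; lra.
have pk0 : 0 <= (1 + l) ^+ k - 1 by rewrite subr_ge0.
have := ler_wpM2l pk0 Mv.
have := ler_normD (u (z ** word G X a) - v) (v - u z); rewrite subrKA.
rewrite exprS; move: step1 step2; set w := (1 + l) ^+ k; lra.
Qed.

Lemma h_convex_continuous x e : Omega x -> 0 < e -> exists2 d, 0 < d &
  forall z, `|coords z - coords x| < d -> `|u z - u x| < e.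
Proof.
move=> Ox e0.
have [r0 r00 r0O] := vopen_ball Omega_open Ox.
have [M [r1 [r10 uM]]] := h_convex_bounded_above u_convex Omega_open u_measurable Ox.
pose r := Num.min r0 r1; have rp : 0 < r by rewrite lt_min r00.
have [k [X [f [X1 charts]]]] := exists_small_charts G.
have [d d0 dP] := translated_word_near G X x rp.
have near_ok z a : `|coords z - coords x| <= d -> (forall j, `|a j| <= d) ->
    Omega (z ** word G X a) /\ u (z ** word G X a) <= M.
  move=> zd ad; have := dP z a zd ad; rewrite lt_min => /andP[h0 h1].
  by split; [apply: r0O | apply/uM/ltW].
have Mx : 0 <= M - u x by rewrite subr_ge0 uM // subrr normr0 ltW.
(* both [x] and [z] are reached from a third point [y] by short words, along
   which the relative oscillation is less than [c0] by the choice of [l] *)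
pose c0 := Num.min (2^-1) (e / (4 * (M - u x + 1))).
have c00 : 0 < c0 by rewrite lt_min invr_gt0 ltr0n /= divr_gt0 // mulr_gt0 // ltr_wpDl.
have [l l01 lc] : exists2 l, 0 < l <= 1 & (1 + l) ^+ k - 1 < c0.
  have pf : polyf (fun t : unit -> R => (1 + t tt) ^+ k).
    by apply: polyfX; apply: polyfD; [apply: polyf_cst | apply: polyf_var].
  have [b b0 bP] := polyf_continuous (fun=> 0) pf c00.
  exists (Num.min 1 b); first by rewrite lt_min ltr01 b0 ge_min lexx.
  have := bP (fun=> Num.min 1 b); rewrite addr0 expr1n => /(_ _)/ltr_normlW; apply => _.
  by rewrite subr0 ger0_norm ?ge_min ?lexx ?orbT // le_min ler01 ltW.
have [l0 l1] := andP l01.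
pose c := (1 + l) ^+ k - 1.
have osc y a : `|coords y - coords x| <= d -> (forall j, `|a j| <= l * d) ->
    `|u (y ** word G X a) - u y| <= c * (M - u y).
  move=> yd al; apply: (h_convex_word_oscillation X1 d0 _ al); first by rewrite ltW.
  by move=> b bd; apply: near_ok.
have pw : polyV (fun a : 'I_k -> R => x ** (- word G X a)).
  apply: polyV_gmul; first exact: polyV_cst.
  apply: polyVN; apply: (@polyV_word _ _ _ _ X _ (fun j a => a j)) => j.
  exact: polyf_var.
have [d1 d10 d1P] := polyV_continuous (fun=> 0) pw d0.
pose m := Num.min (l * d) d1; have m0 : 0 < m by rewrite lt_min d10 mulr_gt0.
have [t tm tU] := charts (m / 2) (divr_gt0 m0 (ltr0n _ 2)).
have flip0 : flip [ffun=> false] t = t.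
  by apply/funext => j; rewrite /flip ffunE mul1r.
have [b [C [b0 C0 _ op]]] := word_chart (tU [ffun=> false]).
rewrite flip0 in op.
pose q := Num.min b (m / 2 / n.+1%:R).
have q0 : 0 < q by rewrite lt_min b0 !divr_gt0.
have [|b' b'0 b'P] := op q; first by rewrite q0 ge_min lexx.
have [d2 d20 d2P] := gmul_continuous G (- x) x b'0.
exists d2 => // z zd2.
have [|s sq sz] := b'P (coords ((- x) ** z)).
  have := d2P (- x) z; rewrite gmulNg coords0 subr0; apply; first by rewrite subrr normr0 ltW.
  exact: ltW.
have {sz} zE : z = x ** (- word G X t) ** word G X (chart_env f t s).
  by rewrite -gmulA (coords_inj sz) gmulNK.
pose y := x ** (- word G X t).
have tm' j : `|t j| <= m by rewrite (le_trans (ltW (tm j))) // ler_pdivrMr // ler_pMr // ler1n.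
have yd : `|coords y - coords x| <= d.
  have := d1P t; rewrite /= word_zero (@oppr0 V) gmulg0 => H; apply/ltW/H => j.
  by rewrite subr0 (le_trans (tm' j)) // ge_min lexx orbT.
have sm j : `|chart_env f t s j| <= m.
  have -> : m = 2 * (m / 2) by rewrite mulrC divfK.
  apply: chart_env_small => [|i|]; [by rewrite ltW // divr_gt0 | exact: ltW |].
  by apply: le_trans sq _; rewrite ge_min lexx orbT.
have ml : m <= l * d by rewrite ge_min lexx.
have := osc y (chart_env f t s) yd (fun j => le_trans (sm j) ml); rewrite -zE.
have := osc y t yd (fun j => le_trans (tm' j) ml); rewrite /y gmulNKr -/y.
have c_ge0 : 0 <= c by rewrite subr_ge0 exprn_ege1 // lerDl ltW.
have c_half : c <= 2^-1 by apply/ltW/(lt_le_trans lc); rewrite ge_min lexx.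
have c_e : c * (4 * (M - u x + 1)) < e.
  rewrite -ltr_pdivlMr; last by rewrite mulr_gt0 // ltr_wpDl.
  by apply: lt_le_trans lc _; rewrite ge_min lexx orbT.
have My : 0 <= M - u y.
  have [_] := near_ok y (fun=> 0) yd (fun j => eq_ind_r (fun v => v <= d) (ltW d0) (normr0 R)).
  by rewrite word_zero gmulg0 subr_ge0.
have := ler_wpM2r My c_half.
move=> cy xy zy.
have yx : M - u y <= 2 * (M - u x) by move: xy; rewrite ler_norml; lra.
have := ler_wpM2l c_ge0 yx.
by move: xy zy; rewrite ltr_norml !ler_norml; lra.
Qed.

End Continuity.

(** * Supporting linear forms *)

Section Subgradients.
Context {R : realType} {V : vectType R} (G : stratified_group V).
Variables (Omega : set V) (u : V -> R).
Hypothesis u_convex : h_convex G Omega u.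
Hypothesis Omega_open : vopen Omega.
Hypothesis u_measurable : vmeasurable_fun Omega u.
Local Notation n := (\dim {:V}).
Local Notation H1 := (layer G 1).
Local Notation "x ** y" := (gmul G x y) (at level 40, left associativity).

Definition coord_form (c : 'I_n -> R) (h : V) : R := \sum_i c i * coords h 0 i.

Lemma coord_formD c h k : coord_form c (h + k) = coord_form c h + coord_form c k.
Proof.
rewrite /coord_form -big_split /=; apply: eq_bigr => i _.
by rewrite coordsD !mxE mulrDr.
Qed.

Lemma coord_formZ c a h : coord_form c (a *: h) = a * coord_form c h.
Proof.
rewrite /coord_form mulr_sumr; apply: eq_bigr => i _.
by rewrite coordsZ !mxE mulrCA.
Qed.

(** These are the horizontal subgradients, written as linear forms in coordinates. *)
Definition supporting (y : V) (c : 'I_n -> R) := forall h, h \in H1 ->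
  (forall t, 0 <= t <= 1 -> Omega (y ** (t *: h))) ->
  u y + coord_form c h <= u (y ** h).

(** A smooth function touching [u] from above at [y] bounds the one-sided
derivatives of [u] by a linear form; by convexity along lines the opposite bound
holds as well. *)
Lemma supporting_of_touching y (phi : ('I_n -> R) -> R) r : polyf phi -> 0 < r ->
  (forall z, `|coords z - coords y| < r -> Omega z /\
     u z - phi (coords z 0) <= u y - phi (coords y 0)) ->
  exists c, supporting y c.
Proof.
move=> pphi r0 touch.
pose psi (t : 'I_n -> R) := phi (coords (y ** of_coords (\row_i t i)) 0).
have psiE h : psi (coords h 0) = phi (coords (y ** h) 0).
  rewrite /psi; congr (phi (coords (_ ** _) 0)); rewrite -[RHS]coordsK; congr of_coords.
  by apply/rowP => i; rewrite mxE.
have ppsi : polyf psi.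
  apply: (polyf_comp (g := fun i (t : 'I_n -> R) => coords (y ** of_coords (\row_i t i)) 0 i) pphi).
  apply: polyV_gmul; first exact: polyV_cst.
  by apply: (polyV_of_coords (f := fun i t => t i)) => i; apply: polyf_var.
have [M pM fM] := polyf_divided_difference ppsi.
pose c i := M i (fun=> 0); exists c => h h1 hO.
(* the difference quotients of [psi] in the direction [-h] *)
pose D (t : R) := \sum_i M i (pair_env (coords (- t *: h) 0) (fun=> 0)) * coords h 0 i.
have psiD t : psi (coords (- t *: h) 0) - psi (fun=> 0) = - t * D t.
  rewrite fM /D mulr_sumr; apply: eq_bigr => i _.
  by rewrite subr0 mulrCA; congr (_ * _); rewrite coordsZ mxE.
have psi0 : psi (fun=> 0) = phi (coords y 0).
  rewrite -[y in RHS](gmulg0 G) -psiE; congr psi; apply/funext => i.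
  by rewrite coords0 mxE.
have [d d0 dP] := line_near G y h r0.
have Dle t : 0 < t <= Num.min 1 d -> D t <= u (y ** h) - u y.
  rewrite le_min => /andP[t0 /andP[t1 td]].
  have Nt : `|- t| <= d by rewrite normrN gtr0_norm.
  have [_] := touch _ (dP _ Nt); rewrite -psiE -psi0 => tch.
  have line : u (y ** ((- t + (1 + t)^-1 * t * (1 - - t)) *: h)) <=
     ((1 + t)^-1 * t) * u (y ** (1 *: h)) + (1 - (1 + t)^-1 * t) * u (y ** (- t *: h)).
    have t1' : 0 < 1 + t by rewrite addr_gt0.
    apply: (h_convex_line u_convex) => //; first by lra.
      move=> s /andP[ts s1]; have [s0|s0] := leP 0 s; first by apply: hO; rewrite s0.
      by apply: (touch _ _).1; apply: dP; rewrite ler_norml; lra.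
    rewrite mulrC; apply/andP; split; first by rewrite divr_ge0 // ltW.
    by rewrite ler_pdivrMr // mul1r; lra.
  have t1' : 1 + t != 0 by rewrite lt0r_neq0 // addr_gt0.
  have E0 : - t + (1 + t)^-1 * t * (1 - - t) = 0 by field.
  rewrite E0 scale0r gmulg0 scale1r in line.
  have line' : (1 + t) * u y <= t * u (y ** h) + u (y ** (- t *: h)).
    have tp : 0 < 1 + t by rewrite addr_gt0.
    have E a b : (1 + t) * ((1 + t)^-1 * t * a + (1 - (1 + t)^-1 * t) * b) = t * a + b.
      by field.
    by rewrite -(ler_pM2l tp) E in line.
  rewrite -(ler_pM2l t0); have := psiD t; lra.
rewrite addrC -lerBrDr.
have -> : coord_form c h = D 0.
  rewrite /D /coord_form; apply: eq_bigr => i _; rewrite /c; congr (M i _ * _).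
  by apply/funext => -[j|j] //=; rewrite oppr0 scale0r coords0 mxE.
have pD : polyf (fun t : unit -> R => D (t tt)).
  apply: polyf_sum => i; apply: polyfM; last exact: polyf_cst.
  apply: (polyf_comp (g := fun a (t : unit -> R) =>
    pair_env (coords (- t tt *: h) 0) (fun=> 0) a) (pM i)).
  case=> j /=; last exact: polyf_cst.
  have : polyV (fun t : unit -> R => - t tt *: h); last by apply.
  by apply: polyVZ; [apply: polyfN; apply: polyf_var | apply: polyV_cst].
rewrite leNgt; apply/negP; rewrite -subr_gt0 => gap.
have [b b0 bP] := polyf_continuous (fun=> 0) pD gap.
pose t := Num.min b (Num.min 1 d).
have t0 : 0 < t by rewrite !lt_min b0 ltr01.
have := bP (fun=> t); rewrite subr0 gtr0_norm // ge_min lexx => /(_ (fun=> isT)).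
have : D t <= u (y ** h) - u y by apply: Dle; rewrite t0 ge_min lexx orbT.
by rewrite ltr_norml; lra.
Qed.

(** The paraboloid [phi] exceeds the oscillation of [u] on the sphere of radius [r],
so that the maximum of [u - phi] on the ball is reached inside. *)
Lemma supporting_dense x e : Omega x -> 0 < e ->
  exists y c, [/\ `|coords y - coords x| < e, Omega y & supporting y c].
Proof.
move=> Ox e0; have [r0 r00 r0O] := vopen_ball Omega_open Ox.
have [M [r1 [r10 uM]]] := h_convex_bounded_above u_convex Omega_open u_measurable Ox.
pose r := Num.min (e / 2) (Num.min (r0 / 2) r1).
have rp : 0 < r by rewrite !lt_min r10 !divr_gt0.
have re : r < e.
  by apply: (@le_lt_trans _ _ (e / 2)); [rewrite ge_min lexx | rewrite gtr_pMr // invf_lt1 // ltr1n].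
have rr0 : r < r0.
  apply: (@le_lt_trans _ _ (r0 / 2)); first by rewrite !ge_min lexx orbT.
  by rewrite gtr_pMr // invf_lt1 // ltr1n.
have rr1 : r <= r1 by rewrite !ge_min lexx !orbT.
pose a := (`|M - u x| + 1) / r ^+ 2.
have a0 : 0 < a by rewrite divr_gt0 ?exprn_gt0 // ltr_wpDl.
pose phi (t : 'I_n -> R) := a * \sum_i (t i - coords x 0 i) ^+ 2.
have pphi : polyf phi.
  apply: polyfM; first exact: polyf_cst.
  apply: polyf_sum => i; apply: polyfX; apply: polyfB; [exact: polyf_var | exact: polyf_cst].
pose f (w : 'rV[R]_n) := u (of_coords (coords x + w)) - phi ((coords x + w) 0).
pose K := [set w : 'rV[R]_n | `|w| <= r].
have Kcompact : compact K.
  apply: bounded_closed_compact.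
    exists r; split; first exact: num_real.
    by move=> b hb w Kw; rewrite /=; apply: le_trans (ltW hb).
  apply: (@closed_comp _ _ (fun w : 'rV[R]_n => `|w|) [set y | y <= r]) => [w _|].
    exact: norm_continuous.
  exact: closed_le.
have Kcont : {within K, continuous f}.
  apply: continuous_in_subspaceT => w; rewrite inE => Kw.
  have Ow : Omega (of_coords (coords x + w)).
    by apply: r0O; rewrite of_coordsK addrC addKr (le_lt_trans Kw).
  apply/(@cvgrPdist_lt _ _ _ (nbhs w) (nbhs_filter w)) => b b0; have b2 : 0 < b / 2 by rewrite divr_gt0.
  have [d d0 dP] := h_convex_continuous u_convex Omega_open u_measurable Ow b2.
  have [d' d'0 d'P] := polyf_continuous ((coords x + w) 0) pphi b2.
  apply/nbhs_ballP; exists (Num.min d d'); first by rewrite /= lt_min d0.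
  move=> w'; rewrite mx_norm_ball /ball_ /= lt_min distrC => /andP[wd wd'].
  have E : (coords x + w') - (coords x + w) = w' - w by rewrite opprD addrACA subrr add0r.
  have h1 := dP (of_coords (coords x + w')); rewrite !of_coordsK E in h1; have {}h1 := h1 wd.
  have h2 : `|phi ((coords x + w') 0) - phi ((coords x + w) 0)| < b / 2.
    by apply: d'P => i; rewrite -rV_subE E; apply/ltW/(le_lt_trans _ wd')/rV_coord_norm.
  by move: h1 h2; rewrite /f !ltr_norml; lra.
have K0 : K 0 by rewrite /K /= normr0 ltW.
have [w /set_mem Kw wmax] := EVT_max_rV (ex_intro _ _ K0) Kcompact Kcont.
have phix : phi (coords x 0) = 0.
  by rewrite /phi big1 ?mulr0 // => i _; rewrite subrr expr0n.
pose v := coords x + w; have vE : v - coords x = w by rewrite /v addrC addKr.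
have vr : `|v - coords x| < r.
  rewrite lt_neqAle vE (Kw : _ <= _) andbT; apply/eqP => wE.
  have := wmax _ (mem_set K0); rewrite /f addr0 coordsK phix subr0 -/v.
  have : u (of_coords v) <= M by apply: uM; rewrite of_coordsK vE wE.
  have : `|M - u x| + 1 <= phi (v 0).
    have [i iE] : exists i, r <= `|v 0 i - coords x 0 i|.
      apply: contrapT => no; have : `|v - coords x| < r.
        by apply/rV_norm_lt => // i; rewrite rV_subE ltNge; apply/negP => ri; apply: no; exists i.
      by rewrite vE wE ltxx.
    have r2 : r ^+ 2 <= (v 0 i - coords x 0 i) ^+ 2.
      by rewrite -[leRHS]real_normK ?num_real // ler_pXn2r // nnegrE ltW.
    have -> : `|M - u x| + 1 = a * r ^+ 2 by rewrite /a divfK // lt0r_neq0 // exprn_gt0.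
    rewrite /phi ler_pM2l // (bigD1 i) //= ler_wpDr // sumr_ge0 // => j _.
    exact: sqr_ge0.
  by have := ler_norm (M - u x); lra.
pose y := of_coords v.
have Oy : Omega y by apply: r0O; rewrite of_coordsK (lt_trans vr).
have [||c cP] := @supporting_of_touching y phi (r - `|v - coords x|) pphi.
- by rewrite subr_gt0.
- move=> z; rewrite of_coordsK => zv.
  have zr : `|coords z - coords x| < r.
    rewrite -[coords z](subrK v) -addrA (le_lt_trans (ler_normD _ _)) //.
    by rewrite -ltrBrDr.
  split; first by apply: r0O; rewrite (lt_trans zr).
  have zE : coords x + (coords z - coords x) = coords z by rewrite addrC subrK.
  have := wmax (coords z - coords x); rewrite /f zE coordsK -/v; apply.
  by apply: mem_set; rewrite /K /= ltW.
by exists y, c; split => //; rewrite of_coordsK (lt_trans vr).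
Qed.

End Subgradients.

(** * Horizontal directional derivatives *)

Section Derivative.
Context {R : realType} {V : vectType R} (G : stratified_group V).
Variables (Omega : set V) (u : V -> R).
Hypothesis u_convex : h_convex G Omega u.
Hypothesis Omega_open : vopen Omega.
Local Notation n := (\dim {:V}).
Local Notation H1 := (layer G 1).
Local Notation "x ** y" := (gmul G x y) (at level 40, left associativity).
Local Notation D := (h_derivative G u).
Local Notation segment_in x h := (forall t, 0 <= t <= 1 -> Omega (x ** (t *: h))).

Lemma line_in x h : Omega x -> exists2 d, 0 < d & forall t, `|t| <= d -> Omega (x ** (t *: h)).
Proof.
move=> Ox; have [r r0 rO] := vopen_ball Omega_open Ox.
by have [d d0 dP] := line_near G x h r0; exists d => // t /dP/rO.
Qed.

Lemma h_quotientE x h t : h \in H1 -> h_quotient G u x h t = (u (x ** (t *: h)) - u x) / t.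
Proof. by move=> h1; rewrite /h_quotient dilation_layer1. Qed.

Lemma h_quotient_le x h s t : h \in H1 -> 0 < s <= t ->
  (forall c, 0 <= c <= t -> Omega (x ** (c *: h))) ->
  h_quotient G u x h s <= h_quotient G u x h t.
Proof.
move=> h1 /andP[s0 st] xO; have t0 : 0 < t := lt_le_trans s0 st.
rewrite !h_quotientE //.
have : u (x ** ((0 + s / t * (t - 0)) *: h)) <=
    s / t * u (x ** (t *: h)) + (1 - s / t) * u (x ** (0 *: h)).
  apply: (h_convex_line u_convex) => //; first exact: ltW.
  apply/andP; split; first by rewrite divr_ge0 // ltW.
  by rewrite ler_pdivrMr // mul1r.
rewrite add0r subr0 divfK ?lt0r_neq0 // scale0r gmulg0 => H.
rewrite ler_pdivrMr // mulrAC [(_ - _) * s]mulrC mulrAC.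
by move: H; set q := s / t; lra.
Qed.

(** The backward slope bounds the forward quotients from below, so they converge. *)
Lemma h_quotient_ge x h d t : h \in H1 -> 0 < d -> 0 < t ->
  (forall c, - d <= c <= t -> Omega (x ** (c *: h))) ->
  (u x - u (x ** (- d *: h))) / d <= h_quotient G u x h t.
Proof.
move=> h1 d0 t0 xO; rewrite h_quotientE //.
have dt : 0 < d + t by rewrite addr_gt0.
have : u (x ** ((- d + (d + t)^-1 * d * (t - - d)) *: h)) <=
    (d + t)^-1 * d * u (x ** (t *: h)) + (1 - (d + t)^-1 * d) * u (x ** (- d *: h)).
  apply: (h_convex_line u_convex) => //; first by lra.
  rewrite mulrC; apply/andP; split; first by rewrite divr_ge0 // ltW.
  by rewrite ler_pdivrMr // mul1r; lra.
have dtN : d + t != 0 := lt0r_neq0 dt.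
have -> : - d + (d + t)^-1 * d * (t - - d) = 0 by field.
rewrite scale0r gmulg0 => H; rewrite -(ler_pM2l dt) in H.
have E a b : (d + t) * ((d + t)^-1 * d * a + (1 - (d + t)^-1 * d) * b) = d * a + t * b by field.
rewrite E in H; rewrite ler_pdivrMr // mulrAC ler_pdivlMr //; lra.
Qed.

Lemma h_derivative_cvg x h : Omega x -> h \in H1 ->
  exists2 d, 0 < d & [/\ cvg (h_quotient G u x h l @[l --> 0^'+]),
    forall t, 0 < t < d -> D x h <= h_quotient G u x h t &
    forall e, 0 < e -> exists2 b, 0 < b & forall t, 0 < t < b -> h_quotient G u x h t < D x h + e].
Proof.
move=> Ox h1; have [d d0 dO] := line_in h Ox; exists d => //.
pose I := Interval (BRight 0) (BLeft d).
have inI t : (t \in I) = (0 < t < d) by rewrite in_itv.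
have mono : {in I &, nondecreasing_fun (h_quotient G u x h)}.
  move=> s t; rewrite !inI => /andP[s0 sd] /andP[t0 td] st.
  by apply: h_quotient_le; rewrite ?s0 // => c c0; apply: dO; rewrite ler_norml; lra.
have lb : has_lbound [set h_quotient G u x h t | t in [set` I]].
  exists ((u x - u (x ** (- d *: h))) / d) => _ [t /= tI <-].
  have /andP[t0 td] : 0 < t < d by rewrite -inI.
  by apply: h_quotient_ge => // c c0; apply: dO; rewrite ler_norml; lra.
have ne : [set h_quotient G u x h t | t in [set` I]] !=set0.
  exists (h_quotient G u x h (d / 2)); exists (d / 2) => //=.
  by rewrite inI divr_gt0 //= ltr_pdivrMr // ltr_pMr // ltr1n.
have lim := @nondecreasing_at_right_cvgr _ (h_quotient G u x h) 0 (BLeft d) d0 mono lb.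
have DE : D x h = inf [set h_quotient G u x h t | t in [set` I]].
  exact: (cvg_lim (@Rhausdorff R) lim).
split; first by apply/cvg_ex; eexists; exact: lim.
  by move=> t td; rewrite DE; apply: ge_inf => //; exists t => //=; rewrite inI.
move=> e e0; have [_ [b /= bI <-] bD] := inf_adherent e0 (conj ne lb).
move: bI; rewrite inI => /andP[b0 bd]; exists b => // t /andP[t0 tb].
rewrite DE; apply: le_lt_trans bD; apply: mono; rewrite ?inI ?b0 ?t0 ?(ltW tb) //.
exact: lt_trans bd.
Qed.

Lemma h_derivative_le x h t : Omega x -> h \in H1 -> 0 < t ->
  (forall c, 0 <= c <= t -> Omega (x ** (c *: h))) -> D x h <= h_quotient G u x h t.
Proof.
move=> Ox h1 t0 xO; have [d d0 [_ Dle _]] := h_derivative_cvg Ox h1.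
pose s := Num.min t (d / 2).
have s0 : 0 < s by rewrite lt_min t0 divr_gt0.
have sd : s < d.
  by apply: (@le_lt_trans _ _ (d / 2)); rewrite ?ge_min ?lexx ?orbT // ltr_pdivrMr // ltr_pMr // ltr1n.
apply: (@le_trans _ _ (h_quotient G u x h s)); first by rewrite Dle // s0.
by apply: h_quotient_le; rewrite ?s0 // ge_min lexx.
Qed.

Lemma h_derivative_homogeneous x h a : Omega x -> h \in H1 -> 0 < a ->
  D x (a *: h) = a * D x h.
Proof.
move=> Ox h1 a0.
suff le c k : k \in H1 -> 0 < c -> D x (c *: k) <= c * D x k.
  apply/eqP; rewrite eq_le le //=.
  have a'0 : 0 < a^-1 by rewrite invr_gt0.
  have := le a^-1 (a *: h) (memvZ _ h1) a'0; rewrite scalerA mulVf ?lt0r_neq0 // scale1r.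
  by rewrite mulrC ler_pdivlMr // mulrC.
move=> k1 c0; apply/ler_addgt0Pr => e e0.
have [d d0 [_ Dle _]] := h_derivative_cvg Ox (memvZ c k1).
have ec : 0 < e / c by rewrite divr_gt0.
have [_ _ [_ _ /(_ _ ec)[b b0 bP]]] := h_derivative_cvg Ox k1.
pose t := Num.min (d / 2) (b / 2 / c).
have t0 : 0 < t by rewrite lt_min !divr_gt0.
have td : t < d.
  by apply: (@le_lt_trans _ _ (d / 2)); rewrite ?ge_min ?lexx // ltr_pdivrMr // ltr_pMr // ltr1n.
have ctb : c * t < b.
  apply: (@le_lt_trans _ _ (b / 2)); last by rewrite ltr_pdivrMr // ltr_pMr // ltr1n.
  by rewrite mulrC -ler_pdivlMr // ge_min lexx orbT.
have q1 : D x (c *: k) <= h_quotient G u x (c *: k) t by apply: Dle; rewrite t0.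
have q2 : h_quotient G u x k (c * t) < D x k + e / c by apply: bP; rewrite mulr_gt0.
have E : h_quotient G u x (c *: k) t = c * h_quotient G u x k (c * t).
  rewrite !h_quotientE ?memvZ // scalerA [t * c]mulrC; field.
  by rewrite !lt0r_neq0.
move: q2; rewrite -(ltr_pM2l c0) mulrDr [c * (e / c)]mulrCA mulfV ?lt0r_neq0 // mulr1 -E.
by move/ltW; apply: le_trans.
Qed.

Hypothesis u_measurable : vmeasurable_fun Omega u.

Lemma translate_continuous x w e : Omega (x ** w) -> 0 < e -> exists2 d, 0 < d &
  forall z, `|coords z - coords x| <= d -> `|u (z ** w) - u (x ** w)| < e.
Proof.
move=> Oxw e0; have [b b0 bP] := h_convex_continuous u_convex Omega_open u_measurable Oxw e0.
have [d d0 dP] := gmul_continuous G x w b0; exists d => // z zd.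
by apply/bP/dP => //; rewrite subrr normr0 ltW.
Qed.

(** At a point [y] with a supporting form the inequality is clear; such points are
dense, and [u] is continuous. The left-hand side is recovered from the backward
quotient at a point of the ray issued from [x] in the direction [h + k]. *)
Lemma h_derivative_subadditive x h k : Omega x -> h \in H1 -> k \in H1 ->
  D x (h + k) <= D x h + D x k.
Proof.
move=> Ox h1 k1; have m1 := memvD h1 k1.
apply/ler_addgt0Pr => e e0; have e4 : 0 < e / 4 by rewrite divr_gt0.
have [? _ [_ _ /(_ _ e4)[bh bh0 bhP]]] := h_derivative_cvg Ox h1.
have [? _ [_ _ /(_ _ e4)[bk bk0 bkP]]] := h_derivative_cvg Ox k1.
have [r r0 rO] := vopen_ball Omega_open Ox.
have [b b0 bP] := gmul_continuous G x 0 r0.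
have nearO z w c : `|coords z - coords x| <= b -> `|coords w| <= b -> `|c| <= 1 ->
    Omega (z ** (c *: w)).
  move=> zb wb c1; apply: rO; have := bP z (c *: w) zb; rewrite gmulg0; apply.
  rewrite coords0 subr0 coordsZ normrZ; apply: le_trans wb.
  by rewrite ler_piMl.
have scale_small w a : 0 <= a -> a <= b / (`|coords w| + 1) -> `|coords (a *: w)| <= b.
  move=> a0; rewrite ler_pdivlMr ?ltr_wpDl // => /(le_trans _); apply.
  by rewrite coordsZ normrZ ger0_norm // ler_wpM2l // lerDl.
pose s := Num.min (Num.min (bh / 2) (bk / 2))
  (Num.min (b / (`|coords h| + 1)) (b / (`|coords k| + 1))).
have s0 : 0 < s by rewrite !lt_min !divr_gt0 // ltr_wpDl.
have half (a : R) : 0 < a -> a / 2 < a by move=> a0; rewrite ltr_pdivrMr // ltr_pMr // ltr1n.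
have sbh : s < bh by apply: le_lt_trans (half _ bh0); rewrite !ge_min lexx.
have sbk : s < bk by apply: le_lt_trans (half _ bk0); rewrite !ge_min lexx orbT.
have sh : `|coords (s *: h)| <= b by apply: scale_small; rewrite ?(ltW s0) // !ge_min lexx !orbT.
have sk : `|coords (s *: k)| <= b by apply: scale_small; rewrite ?(ltW s0) // !ge_min lexx !orbT.
have xb : `|coords x - coords x| <= b by rewrite subrr normr0 ltW.
have qh : u (x ** (s *: h)) - u x < s * (D x h + e / 4).
  have : h_quotient G u x h s < D x h + e / 4 by apply: bhP; rewrite s0.
  by rewrite h_quotientE // ltr_pdivrMr // mulrC.
have qk : u (x ** (s *: k)) - u x < s * (D x k + e / 4).
  have : h_quotient G u x k s < D x k + e / 4 by apply: bkP; rewrite s0.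
  by rewrite h_quotientE // ltr_pdivrMr // mulrC.
(* [e] is shared equally between the two forward quotients, the passage from
   [z] to [x] in these quotients, and the backward quotient *)
have se : 0 < s * e / 16 by rewrite divr_gt0 // mulr_gt0.
have O1 : Omega (x ** 0) by rewrite gmulg0.
have Oh : Omega (x ** (s *: h)) by rewrite -[s *: h]scale1r; apply: nearO; rewrite ?normr1.
have Ok : Omega (x ** (s *: k)) by rewrite -[s *: k]scale1r; apply: nearO; rewrite ?normr1.
have [d0 d00 d0P] := translate_continuous O1 se.
have [dh dh0 dhP] := translate_continuous Oh se.
have [dk dk0 dkP] := translate_continuous Ok se.
pose d := Num.min b (Num.min d0 (Num.min dh dk)).
have dp : 0 < d by rewrite !lt_min b0 d00 dh0.
have d2 : 0 < d / 2 by rewrite divr_gt0.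
have [dm dm0 dmP] := line_near G x (h + k) d2.
pose t := Num.min dm (b / (`|coords (h + k)| + 1)).
have t0 : 0 < t by rewrite lt_min dm0 divr_gt0 // ltr_wpDl.
have tb : t <= b / (`|coords (h + k)| + 1) by rewrite ge_min lexx orbT.
have tm : `|coords (t *: (h + k))| <= b by apply: scale_small => //; apply: ltW.
pose y := x ** (t *: (h + k)).
have yx : `|coords y - coords x| < d / 2 by apply: dmP; rewrite gtr0_norm // ge_min lexx.
have Oy : Omega y by rewrite /y -[t *: _]scale1r; apply: nearO; rewrite ?normr1.
have back : y ** (- (t *: (h + k))) = x by rewrite /y gmulKNr.
have te : 0 < t * e / 8 by rewrite divr_gt0 // mulr_gt0.
have Oy0 : Omega (y ** 0) by rewrite gmulg0.
have Oback : Omega (y ** (- (t *: (h + k)))) by rewrite back.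
have [a0 a00 a0P] := translate_continuous Oy0 te.
have [a1 a10 a1P] := translate_continuous Oback te.
have ap : 0 < Num.min (d / 2) (Num.min a0 a1) by rewrite !lt_min d2 a00.
have [z [c [zy Oz supp]]] := supporting_dense u_convex Omega_open u_measurable Oy ap.
move: zy; rewrite !lt_min => /and3P[zy za0 za1].
have zx : `|coords z - coords x| <= d.
  by have := ler_distD (coords y) (coords z) (coords x); move: zy yx; lra.
move: (zx); rewrite !le_min => /and4P[zb zd0 zdh zdk].
have suppw w : w \in H1 -> `|coords w| <= b -> u z + coord_form c w <= u (z ** w).
  move=> w1 wb; apply: supp => // l /andP[l0 l1]; apply: nearO => //.
  by rewrite ger0_norm.
have Sh := suppw _ (memvZ s h1) sh; have Sk := suppw _ (memvZ s k1) sk.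
have Sm := suppw (- (t *: (h + k))).
rewrite memvN memvZ // coordsN normrN tm in Sm; have {}Sm := Sm isT isT.
rewrite -scaleNr !coord_formZ coord_formD scaleNr in Sh Sk Sm.
have Dm : t * D x (h + k) <= u y - u x.
  have : D x (h + k) <= h_quotient G u x (h + k) t.
    apply: h_derivative_le => // l /andP[l0 lt_]; rewrite -[l *: _]scale1r.
    by apply: nearO; rewrite ?normr1 //; apply: scale_small => //; apply: le_trans tb.
  by rewrite h_quotientE // ler_pdivlMr // mulrC.
have := a0P z (ltW za0); have := a1P z (ltW za1); rewrite back !gmulg0.
have := d0P z zd0; have := dhP z zdh; have := dkP z zdk; rewrite !gmulg0.
rewrite !ltr_norml => K1 K2 K3 K4 K5.
have up : coord_form c h + coord_form c k <= D x h + D x k + 3 * (e / 4).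
  by rewrite -(ler_pM2l s0); move: K1 K2 K3 Sh Sk qh qk; lra.
have down : D x (h + k) <= coord_form c h + coord_form c k + e / 4.
  by rewrite -(ler_pM2l t0); move: K4 K5 Sm Dm; lra.
by lra.
Qed.

End Derivative.

(** * Sublinear functions and the scalar product *)

Section Sublinear.
Context {R : realType} {V : vectType R}.
Implicit Types F g : V -> R.

Definition sublinear F := (forall a v, 0 < a -> F (a *: v) = a * F v) /\
  (forall v w, F (v + w) <= F v + F w).

Lemma sublinear0 F : sublinear F -> F 0 = 0.
Proof. by case=> FZ _; have := FZ 2 0 (ltr0n _ 2); rewrite scaler0; lra. Qed.

Lemma sublinear_opp F v : sublinear F -> 0 <= F v + F (- v).
Proof. by move=> sF; have := sF.2 v (- v); rewrite subrr sublinear0. Qed.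

(** The directional derivative of [F] at [e], a sublinear minorant of [F] that is
linear on the line of [e]. *)
Lemma sublinear_linearize F e : sublinear F ->
  exists g, [/\ sublinear g, forall v, g v <= F v, g (- e) = - g e & g e = F e].
Proof.
move=> sF; have [FZ FD] := sF.
pose E v := [set F (v + s *: e) - s * F e | s in [set s | 0 <= s]].
have Elb v : lbound (E v) (- F (- v)).
  move=> _ [s /= s0 <-]; have := FD (v + s *: e) (- v).
  rewrite addrAC subrr add0r.
  have -> : F (s *: e) = s * F e.
    have [->|sN0] := eqVneq s 0; first by rewrite scale0r mul0r sublinear0.
    by rewrite FZ // lt_neqAle eq_sym sN0.
  by lra.
have Ehas v : has_lbound (E v) by exists (- F (- v)); apply: Elb.
have En0 v : E v !=set0 by exists (F (v + 0 *: e) - 0 * F e); exists 0 => //=.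
pose g v := inf (E v).
have gle v s : 0 <= s -> g v <= F (v + s *: e) - s * F e.
  by move=> s0; apply: ge_inf => //; exists s.
have gF v : g v <= F v by have := gle v 0 (lexx 0); rewrite scale0r addr0 mul0r subr0.
have gZle a v : 0 < a -> g (a *: v) <= a * g v.
  move=> a0; rewrite mulrC -ler_pdivrMr //; apply: lb_le_inf => // _ [s /= s0 <-].
  rewrite ler_pdivrMr // mulrBl mulrAC [F _ * a]mulrC -FZ // scalerDr scalerA [s * a]mulrC.
  by apply: gle; rewrite mulr_ge0 // ltW.
have sg : sublinear g.
  split=> [a v a0|v w].
    apply/eqP; rewrite eq_le gZle //=.
    have a'0 : 0 < a^-1 by rewrite invr_gt0.
    have := gZle a^-1 (a *: v) a'0; rewrite scalerA mulVf ?lt0r_neq0 // scale1r.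
    by rewrite mulrC ler_pdivlMr // mulrC.
  rewrite -lerBlDr; apply: lb_le_inf => // _ [s /= s0 <-].
  rewrite lerBlDr -lerBlDl; apply: lb_le_inf => // _ [r /= r0 <-].
  have := gle (v + w) (s + r) (addr_ge0 s0 r0).
  rewrite scalerDl addrACA; have := FD (v + s *: e) (w + r *: e).
  by lra.
have := gle (- e) 1 ler01; rewrite scale1r addNr sublinear0 // mul1r sub0r.
have := gF e; have := sublinear_opp e sg => g1 g2 g3.
by exists g; split => //; lra.
Qed.

(** Passing to a smaller sublinear function keeps the lines on which the previous
one was already linear. *)
Lemma sublinear_linearize_seq F (s : seq V) : sublinear F ->
  exists g, [/\ sublinear g, forall v, g v <= F v & forall e, e \in s -> g (- e) = - g e].
Proof.
elim: s F => [|e s IHs] F sF; first by exists F.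
have [f [sf fF fe _]] := sublinear_linearize e sF.
have [g [sg gf gs]] := IHs f sf; exists g; split => // [v|v].
  exact: le_trans (gf v) (fF v).
rewrite in_cons => /orP[/eqP ->|]; last exact: gs.
by have := gf e; have := gf (- e); have := sublinear_opp e sg; lra.
Qed.

(** Linearizing along [h] first fixes the value at [h]; a sublinear function that
is linear on the line of each basis vector is linear. *)
Lemma sublinear_support F h : sublinear F ->
  exists g, [/\ forall a v w, g (a *: v + w) = a * g v + g w, forall v, g v <= F v & g h = F h].
Proof.
move=> sF; have [f [sf fF fh fFh]] := sublinear_linearize h sF.
have [g [sg gf gs]] := sublinear_linearize_seq (vbasis {:V}) sf.
have [gZ gD] := sg.
have gadd v w : g (- v) = - g v -> g (v + w) = g v + g w.
  move=> gv; apply/eqP; rewrite eq_le gD /=.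
  by have := gD (v + w) (- v); rewrite addrAC subrr add0r gv; lra.
have gscale a v : g (- v) = - g v -> g (a *: v) = a * g v.
  move=> gv; have [a0|a0|->] := ltgtP a 0; last by rewrite scale0r mul0r sublinear0.
    rewrite -[a]opprK scaleNr -scalerN gZ ?oppr_gt0 // gv; ring.
  exact: gZ.
have godd v : g (- v) = - g v.
  rewrite (coords_expand v).
  elim/big_ind : _ => [|y z gy gz|i _]; first by rewrite oppr0 sublinear0 // oppr0.
    have gNy : g (- - y) = - g (- y) by rewrite opprK gy opprK.
    by rewrite opprD !gadd // gy gz opprD.
  have ge : g (- (vbasis {:V})`_i) = - g (vbasis {:V})`_i.
    by apply: gs; rewrite mem_nth // size_tuple.
  by rewrite -scaleNr !gscale // mulNr.
exists g; split => [a v w|v|]; first by rewrite gadd // gscale.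
  exact: le_trans (gf v) (fF v).
by have := gf h; have := gf (- h); have := sublinear_opp h sg; lra.
Qed.

(** The Gram matrix of a basis is invertible because the form is definite. *)
Lemma riesz_subspace (ip : {dot V for idfun}) (U : {vspace V}) (g : V -> R) :
  (forall a v w, g (a *: v + w) = a * g v + g w) ->
  exists2 p, p \in U & forall h, h \in U -> ip p h = g h.
Proof.
move=> glin; pose b := vbasis U; pose m := \dim U.
pose A : 'M[R]_m := \matrix_(i, j) ip b`_i b`_j.
have bU i : (i < m)%N -> b`_i \in U by move=> im; apply/vbasis_mem/mem_nth; rewrite size_tuple.
have comb (r : 'rV[R]_m) (j : 'I_m) : ip (\sum_i r 0 i *: b`_i) b`_j = (r *m A) 0 j.
  rewrite linear_sumlz mxE; apply: eq_bigr => i _.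
  by rewrite linearZl_LR mxE.
have Aunit : A \in unitmx.
  rewrite -row_free_unit -kermx_eq0; apply/eqP/row_matrixP => k; rewrite row0.
  set r := row k _; pose v := \sum_i r 0 i *: b`_i.
  have rA : r *m A = 0 by rewrite -row_mul mulmx_ker row0.
  have v0 : v = 0.
    apply/eqP/negPn/negP => /(neq0_dnorm_gt0 (s := ip)).
    rewrite {2}/v linear_sumr big1 ?ltxx // => i _.
    by rewrite linearZr_LR /= comb rA [X in _ * X]mxE mulr0.
  apply/rowP => i; rewrite [RHS]mxE.
  have /freeP := basis_free (vbasisP U); apply => //.
pose r : 'rV[R]_m := (\row_j g b`_j) *m invmx A.
exists (\sum_i r 0 i *: b`_i).
  by apply: memv_suml => i _; apply: memvZ; apply: bU.
move=> h hU; rewrite (coord_vbasis hU).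
have g0 : g 0 = 0 by have := glin (-1) 0 0; rewrite scaler0 addr0; lra.
have gadd v w : g (v + w) = g v + g w by have := glin 1 v w; rewrite scale1r mul1r.
have gZ a v : g (a *: v) = a * g v by have := glin a v 0; rewrite !addr0 g0 addr0.
rewrite linear_sumr (big_morph g gadd g0); apply: eq_bigr => j _.
by rewrite linearZr_LR /= comb /r mulmxKV // mxE gZ.
Qed.

End Sublinear.

(** * The derivative as a support function *)

Unset Implicit Arguments.

Theorem corollary3p3 (R : realType) (V : vectType R) (G : stratified_group V)
    (ip : {dot V for idfun}) (ip_layers : orthogonal_layers G ip)
    (Omega : set V) (Omega_open : vopen Omega)
    (u : V -> R) (u_measurable : vmeasurable_fun Omega u)
    (u_convex : h_convex G Omega u) (x : V) (Omega_x : Omega x) :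
  (forall h, h \in layer G 1 ->
     cvg (h_quotient G u x h l @[l --> 0^'+]) /\
     is_max [set ip p h | p in h_subdifferential G ip Omega u x]
       (h_derivative G u x h)) /\
  (forall h k, h \in layer G 1 -> k \in layer G 1 ->
     h_derivative G u x (h + k)
       <= h_derivative G u x h + h_derivative G u x k).
Proof.
split; last first.
  move=> h k h1 k1.
  exact: (h_derivative_subadditive u_convex Omega_open u_measurable Omega_x h1 k1).
move=> h h1; have [d d0 [hcvg _ hD]] := h_derivative_cvg u_convex Omega_open Omega_x h1.
split => //; pose P := projv (layer G 1).
have PH v : P v \in layer G 1 by apply: memv_proj.
have sF : sublinear (fun v => h_derivative G u x (P v)).
  split=> [a v a0|v w].
    rewrite linearZ.
    exact: (h_derivative_homogeneous u_convex Omega_open Omega_x (PH v) a0).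
  rewrite linearD.
  exact: (h_derivative_subadditive u_convex Omega_open u_measurable Omega_x (PH v) (PH w)).
have hsegmentP k : hsegment k `<=` gmul G (ginv x) @` Omega ->
    forall t, 0 <= t <= 1 -> Omega (gmul G x (t *: k)).
  move=> kO t t01; have [|z Oz <-] := kO (t *: k); last by rewrite /ginv gmulNK.
  by exists t => //=; rewrite in_itv.
split.
  have [g [glin gF gh]] := sublinear_support h sF.
  have [p pH pg] := riesz_subspace ip (layer G 1) glin.
  exists p; last by rewrite pg // gh /P projv_id.
  split => // k k1 /hsegmentP kO; rewrite pg // -lerBrDl.
  apply: le_trans (gF k) _; rewrite /P projv_id //.
  have := h_derivative_le u_convex Omega_open Omega_x k1 ltr01 kO.
  by rewrite h_quotientE // scale1r divr1.
move=> _ [p [p1 psub] <-]; apply/ler_addgt0Pr => e e0.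
have [b b0 bP] := hD e e0; have [c c0 cO] := line_in G Omega_open h Omega_x.
pose t := Num.min (b / 2) c.
have t0 : 0 < t by rewrite lt_min divr_gt0.
have tb : t < b.
  apply: (@le_lt_trans _ _ (b / 2)); first by rewrite ge_min lexx.
  by rewrite ltr_pdivrMr // ltr_pMr // ltr1n.
have := bP t; rewrite t0 => /(_ tb)/ltW; apply: le_trans.
rewrite h_quotientE // ler_pdivlMr // lerBrDl mulrC.
have := psub (t *: h) (memvZ t h1); rewrite linearZr_LR; apply.
move=> _ [s s01 <-]; exists (gmul G x (s *: (t *: h))); last by rewrite /ginv gmulKN.
rewrite scalerA; apply: cO; move: s01; rewrite /= in_itv /= => /andP[s0 s1].
rewrite normrM !ger0_norm // ?(ltW t0) //; apply: (@le_trans _ _ t).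
  by rewrite ler_piMl // ltW.
by rewrite ge_min lexx orbT.
Qed.
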